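(* Let $n\geq 1$ and $k\geq 1$ be integers and let $\lambda$ be a partition. Then, as formal power series in the variables $\{x_{i,j}: i\in\mathbb{Z}/n\mathbb{Z},\ j\in\mathbb{Z}_{\geq 1}\}$, \[ p_k[n]\,s_\lambda[n]=\sum_\sigma (-1)^{ht(\sigma\setminus\lambda)}\,s_\sigma[n], \] where the sum is over all partitions $\sigma$ obtained from $\lambda$ by adding a border strip of length $kn$.
   Context: A partition is identified with its Young diagram (English convention: rows justified to the northwest, row $i$ having $\lambda_i$ boxes, rows and columns indexed from $1$). The box $\square$ in row $i$ and column $j$ has content $j-i$ and color $j-i \bmod n$. A semi-standard Young tableau (SSYT) of $\lambda$ is an assignment of positive integers to the boxes of $\lambda$, weakly increasing from left to right along rows and strictly increasing from top to bottom along columns; $w(\square,T)$ is the number in box $\square$ of $T$. Loop Schur function: $s_\lambda[n]:=\sum_{T} x^T$, the sum over all SSYT $T$ of $\lambda$, where $x^T:=\prod_{\square\in\lambda}x_{c,\,w(\square,T)}$ with $c\in\mathbb{Z}/n\mathbb{Z}$ the color of $\square$. Loop power-sum function: $p_k[n]:=\sum_{j\geq 1}\left(\prod_{i=0}^{n-1}x_{i,j}\right)^k$. Border strip: $\sigma$ is obtained from $\lambda$ by adding a length $m$ border strip if $\sigma\supset\lambda$ are Young diagrams such that the complement $\sigma\setminus\lambda$ is connected (boxes adjacent along edges), contains exactly $m$ boxes, and contains no $2\times 2$ square. The height $ht(\sigma\setminus\lambda)$ is the number of rows occupied by $\sigma\setminus\lambda$, minus $1$. *)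

(* Defs.v *)
From HB Require Import structures.
From mathcomp Require Import all_boot all_algebra finmap.
From mathcomp Require Import boolp classical_sets functions cardinality fsbigop.
From mathcomp Require Import monalg.

Set Implicit Arguments.
Unset Strict Implicit.
Unset Printing Implicit Defensive.

Import GRing.Theory.

Local Open Scope classical_set_scope.
Local Open Scope ring_scope.

(* Formal power series with integer coefficients in a possibly infinite set I *)
(* of commuting variables: arbitrary families of coefficients indexed by the  *)
(* monomials {cmonom I} (finitely supported exponent functions I -> nat).     *)
Record fps (I : choiceType) := Fps { fcoef :> {cmonom I} -> int }.

Section FormalPowerSeries.
Variable I : choiceType.
Implicit Types (f g h : fps I) (m a b : {cmonom I}).

HB.instance Definition _ := [isNew for @fcoef I].
HB.instance Definition _ := gen_eqMixin (fps I).
HB.instance Definition _ := gen_choiceMixin (fps I).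

Lemma fpsP f g : (forall m, f m = g m) -> f = g.
Proof. by case: f g => [f] [g] fg; congr Fps; apply/funext. Qed.

Lemma finite_divisors m : finite_set [set a | exists b, mmul a b = m].
Proof.
pose F (e : {ffun finsupp m -> 'I_(mdeg m).+1}) : {cmonom I} :=
  mkcmonom [fsfun i : finsupp m => nat_of_ord (e i) | 0%N].
apply: (sub_finite_set _ (finite_image F (@finite_finset _ setT))).
move=> a [b abm]; have le_am i : (a i <= m i)%N by rewrite -abm cmM leq_addr.
exists [ffun i : finsupp m => inord (a (fsval i))] => //.
apply/eqP/cmP => i; rewrite /F cmE.
have [im|iNm] := boolP (i \in finsupp m); last first.
  rewrite fsfun_ffun insubF ?(negbTE iNm) //.
  have := le_am i; have /eqP -> : m i == 0%N by rewrite cmE_eq0.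
  by rewrite leqn0 => /eqP.
rewrite fsfun_ffun insubT /= ffunE inordK //= ltnS (leq_trans (le_am i)) //.
by rewrite mdegE (big_fsetD1 i) //= leq_addr.
Qed.

Lemma finite_factorizations m :
  finite_set [set ab : {cmonom I} * {cmonom I} | mmul ab.1 ab.2 = m].
Proof.
pose D := [set a | exists b, mmul a b = m].
apply: (@sub_finite_set _ _ (D `*` D)); last first.
  by apply: finite_setX; apply: finite_divisors.
by move=> [a b] /= abm; split=> /=; [exists b | exists a; rewrite mulmC].
Qed.

Definition fps_zero : fps I := Fps (fun _ => 0).
Definition fps_one : fps I := Fps (fun m => (m == mone)%:R).
Definition fps_opp f : fps I := Fps (fun m => - f m).
Definition fps_add f g : fps I := Fps (fun m => f m + g m).
Definition fps_mul f g : fps I :=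
  Fps (fun m => \sum_(ab \in [set ab | mmul ab.1 ab.2 = m]) f ab.1 * g ab.2).

Let addA : associative fps_add.
Proof. by move=> f g h; apply/fpsP => m /=; rewrite addrA. Qed.
Let addC : commutative fps_add.
Proof. by move=> f g; apply/fpsP => m /=; rewrite addrC. Qed.
Let add0 : left_id fps_zero fps_add.
Proof. by move=> f; apply/fpsP => m /=; rewrite add0r. Qed.
Let addN : left_inverse fps_zero fps_opp fps_add.
Proof. by move=> f; apply/fpsP => m /=; rewrite addNr. Qed.

HB.instance Definition _ := GRing.isZmodule.Build (fps I) addA addC add0 addN.

Definition divisors m : seq {cmonom I} :=
  fset_set [set a | exists b, mmul a b = m].

Lemma mem_divisors a m : reflect (exists b, mmul a b = m) (a \in divisors m).
Proof.
by rewrite /divisors in_fset_set ?inE; [apply: asboolP|apply: finite_divisors].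
Qed.

Lemma divisors_uniq m : uniq (divisors m).
Proof. exact: fset_uniq. Qed.

Lemma fps_mulE (X : seq {cmonom I}) f g m :
    uniq X -> {subset divisors m <= X} ->
  fps_mul f g m =
  \sum_(a <- X) \sum_(b <- X) if mmul a b == m then f a * g b else 0.
Proof.
move=> uX sX; rewrite /= fsbig_finite; last exact: finite_factorizations.
pose F (ab : {cmonom I} * {cmonom I}) := f ab.1 * g ab.2.
rewrite -(big_allpairs (F := fun ab => if mmul ab.1 ab.2 == m then F ab else 0)).
rewrite -big_mkcond -[RHS]big_filter; apply: perm_big.
apply: uniq_perm; first exact: fset_uniq.
  by rewrite filter_uniq // allpairs_uniq // => -[? ?] [? ?].
move=> [a b]; rewrite in_fset_set; last exact: finite_factorizations.
rewrite mem_filter /=; apply/idP/idP => [|/andP[/eqP abm _]]; last by rewrite inE.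
rewrite inE /= => abm; rewrite abm eqxx /=; apply/allpairsP; exists (a, b).
split=> //=; apply/sX/mem_divisors; first by exists b.
by exists a; rewrite mulmC.
Qed.

Let big_delta (X : seq {cmonom I}) (P : pred {cmonom I}) u (v : int) :
    uniq X -> (P u -> u \in X) ->
  \sum_(b <- X) (if P b then if u == b then v else 0 else 0) =
  if P u then v else 0.
Proof.
move=> uX; case: ifPn => [Pu /(_ isT) uinX | NPu _].
  rewrite (bigD1_seq u) //= Pu eqxx big1 ?addr0 // => b /negbTE.
  by rewrite eq_sym => ->; case: ifP.
by rewrite big1 // => b _; case: (eqVneq u b) => [<-|]; rewrite ?(negbTE NPu) ?if_same.
Qed.

Let mulC : commutative fps_mul.
Proof.
move=> f g; apply/fpsP => m.
rewrite !(@fps_mulE (divisors m)) ?divisors_uniq // exchange_big.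
apply: eq_bigr => a _; apply: eq_bigr => b _.
by rewrite mulmC; case: ifP; rewrite // mulrC.
Qed.

Let divisors_trans m a : a \in divisors m -> {subset divisors a <= divisors m}.
Proof.
move=> /mem_divisors[b <-] c /mem_divisors[d <-]; apply/mem_divisors.
by exists (mmul d b); rewrite mulmA.
Qed.

Let mul3E f g h m : let X := divisors m in
  fps_mul f (fps_mul g h) m =
  \sum_(a <- X) \sum_(c <- X) \sum_(d <- X)
    if mmul a (mmul c d) == m then f a * (g c * h d) else 0.
Proof.
move=> X; have uX : uniq X by apply: divisors_uniq.
rewrite (@fps_mulE X) //; apply: eq_bigr => a _.
pose F b c d := if mmul a b == m then
  if mmul c d == b then f a * (g c * h d) else 0 else 0.
transitivity (\sum_(b <- X) \sum_(c <- X) \sum_(d <- X) F b c d).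
  apply: eq_big_seq => b bX; rewrite /F; case: ifP => _; last first.
    by rewrite big1 // => c _; rewrite big1.
  rewrite (@fps_mulE X) //; last exact: divisors_trans.
  rewrite mulr_sumr; apply: eq_bigr => c _; rewrite mulr_sumr.
  by apply: eq_bigr => d _; case: ifP; rewrite ?mulr0.
rewrite exchange_big; apply: eq_bigr => c _.
rewrite exchange_big; apply: eq_bigr => d _.
rewrite (@big_delta X (fun b => mmul a b == m)) // => /eqP acdm.
by apply/mem_divisors; exists a; rewrite mulmC.
Qed.

Let mulA : associative fps_mul.
Proof.
move=> f g h; rewrite [in RHS]mulC; apply/fpsP => m; rewrite !mul3E.
rewrite [RHS]exchange_big; apply: eq_bigr => a _.
rewrite [RHS]exchange_big; apply: eq_bigr => b _; apply: eq_bigr => c _.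
rewrite mulmA [mmul c _]mulmC; case: ifP => // _.
by rewrite mulrA mulrC.
Qed.

Let mul1 : left_id fps_one fps_mul.
Proof.
move=> f; apply/fpsP => m; have uX := divisors_uniq m.
rewrite (@fps_mulE (divisors m)) // exchange_big.
rewrite (bigD1_seq m) ?divisors_uniq //=; last first.
  by apply/mem_divisors; exists mone; rewrite mulm1.
rewrite (bigD1_seq mone) //=; last by apply/mem_divisors; exists m; rewrite mul1m.
rewrite mul1m !eqxx mul1r big1 ?addr0 => [|a /negbTE ->]; last first.
  by rewrite mul0r if_same.
rewrite big1 ?addr0 // => b bm; rewrite big1 // => a _.
have [->|] := eqVneq a mone; first by rewrite mul1m (negbTE bm).
by rewrite mul0r if_same.
Qed.

Let mulDl : left_distributive fps_mul +%R.
Proof.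
move=> f g h; apply/fpsP => m.
transitivity (fps_mul f h m + fps_mul g h m); last by [].
rewrite !(@fps_mulE (divisors m)) ?divisors_uniq //.
rewrite -big_split; apply: eq_bigr => a _; rewrite -big_split.
by apply: eq_bigr => b _; case: ifP; rewrite ?addr0 //= mulrDl.
Qed.

Let one_neq0 : fps_one != 0.
Proof. by apply/eqP => /(congr1 (fun f : fps I => f mone)) /=; rewrite eqxx. Qed.

HB.instance Definition _ :=
  GRing.Zmodule_isComNzRing.Build (fps I) mulA mulC mul1 mulDl one_neq0.

End FormalPowerSeries.

Arguments fps_mul : simpl never.

Definition fps_var (I : choiceType) (i : I) : fps I :=
  Fps (fun m => (m == ucm i)%:R).

Definition fps_monom (I : choiceType) (a : {cmonom I}) : fps I :=
  Fps (fun m => (m == a)%:R).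

Lemma fps_coefM (I : choiceType) (f g : fps I) (m : {cmonom I}) :
  (f * g) m = \sum_(ab \in [set ab | mmul ab.1 ab.2 = m]) f ab.1 * g ab.2.
Proof. by []. Qed.

Lemma fps_monomM (I : choiceType) (a b : {cmonom I}) :
  fps_monom (mmul a b) = fps_monom a * fps_monom b.
Proof.
apply/fpsP => m; rewrite fps_coefM fsbig_finite; last first.
  exact: finite_factorizations.
rewrite {1}/fps_monom [LHS]/fcoef.
have [mab|mNab] := eqVneq m (mmul a b).
  rewrite (bigD1_seq (a, b)) ?fset_uniq //=; last first.
    by rewrite in_fset_set ?inE //; exact: finite_factorizations.
  rewrite !eqxx mulr1 big1 ?addr0 // => -[c d] /=; rewrite xpair_eqE.
  by case: (c == a); case: (d == b); rewrite //= ?mul0r ?mulr0.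
rewrite big_seq big1 // => -[c d].
rewrite in_fset_set; last exact: finite_factorizations.
rewrite inE /= => cdm; have [ca|] := eqVneq c a; last by rewrite mul0r.
have [db|] := eqVneq d b; last by rewrite mulr0.
by rewrite -cdm ca db eqxx in mNab.
Qed.

Lemma prod_fps_var (I : choiceType) (J : finType) (v : J -> I) :
  \prod_j fps_var (v j) = fps_monom (\big[mmul/mone]_j ucm (v j)).
Proof.
apply/esym/(big_morph (@fps_monom I)); last by [].
exact: fps_monomM.
Qed.

Lemma prod_fps_var_supp (I : choiceType) (J : finType) (v : J -> I)
    (m : {cmonom I}) j :
  (\prod_j fps_var (v j)) m != 0 -> v j \in finsupp m.
Proof.
rewrite prod_fps_var /=; have [->|//] := eqVneq m _.
by rewrite -cmE_neq0 (bigD1 j) //= cmM cmUU.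
Qed.

(* The infinite sum of a family of power series of which only finitely many   *)
(* members contribute to any given monomial.                                  *)
Definition fps_sum (I T : choiceType) (F : T -> fps I) : fps I :=
  Fps (fun m => \sum_(t \in [set: T]) F t m).

Definition fps_summable (I T : choiceType) (F : T -> fps I) : Prop :=
  forall m, finite_set [set t | F t m != 0].

Definition posnat := {j : nat | (0 < j)%N}.

(* For n >= 1 this is Z/nZ: 'I_p.+1 carries the additive group structure of   *)
(* the integers modulo p + 1, including for p = 0.                            *)
Definition color (n : nat) : finZmodType := 'I_n.-1.+1.

Definition loop_var (n : nat) : choiceType := (color n * posnat)%type.

Definition loop_x (n : nat) (i : color n) (j : posnat) : fps (loop_var n) :=
  fps_var ((i, j) : loop_var n).

Record intpart := IntPart {
  parts :> seq nat;
  _ : sorted geq parts && (0%N \notin parts) }.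

HB.instance Definition _ := [isSub for parts].
HB.instance Definition _ := [Choice of intpart by <:].

(* Rows and columns of Young diagrams are numbered from 0, which affects      *)
(* neither contents nor shapes.                                               *)
Definition in_diagram (la : intpart) (r c : nat) : bool :=
  (c < nth 0%N la r)%N.

Definition box (la : intpart) : finType :=
  {r : 'I_(size la) & 'I_(nth 0%N la r)}.

Definition box_row (la : intpart) (b : box la) : nat := tag b.
Definition box_col (la : intpart) (b : box la) : nat := tagged b.

(* The content box_col b - box_row b, reduced modulo n. *)
Definition box_color (n : nat) (la : intpart) (b : box la) : color n :=
  inZp (box_col b) - inZp (box_row b).

Definition is_ssyt (la : intpart) (T : {ffun box la -> posnat}) : bool :=
  [forall b, forall b',
    ((box_row b == box_row b') && (box_col b <= box_col b')%N ==>
       (val (T b) <= val (T b'))%N) &&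
    ((box_col b == box_col b') && (box_row b < box_row b')%N ==>
       (val (T b) < val (T b'))%N)].

Definition ssyt (la : intpart) := {T : {ffun box la -> posnat} | is_ssyt T}.

Definition ssyt_weight (n : nat) (la : intpart) (T : ssyt la) :
    fps (loop_var n) :=
  \prod_(b : box la) loop_x (box_color n b) (val T b).

Definition loop_schur (n : nat) (la : intpart) : fps (loop_var n) :=
  fps_sum (@ssyt_weight n la).

Definition loop_power_sum (n k : nat) : fps (loop_var n) :=
  fps_sum (fun j : posnat => (\prod_(i : color n) loop_x i j) ^+ k).

Lemma ssyt_weight_summable n la : fps_summable (@ssyt_weight n la).
Proof.
move=> m; pose B := [set T : {ffun box la -> posnat} |
  forall b, (box_color n b, T b) \in finsupp m].
pose F (g : {ffun box la -> finsupp m}) := [ffun b => (fsval (g b)).2].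
have finB : finite_set B.
  apply: (sub_finite_set _ (finite_image F (@finite_finset _ setT))).
  move=> T TB; exists [ffun b => FSetSub (TB b)] => //.
  by apply/ffunP => b; rewrite !ffunE.
apply: (sub_finite_set _ (finite_preimage _ finB)) => [T /= Tm b|].
  exact: (prod_fps_var_supp (v := fun b => (box_color n b, val T b))).
by move=> T T' _ _; apply: val_inj.
Qed.

Lemma loop_power_sum_summable n k : (0 < k)%N ->
  fps_summable (fun j : posnat => (\prod_(i : color n) loop_x i j) ^+ k).
Proof.
move=> k_gt0 m; pose F (v : finsupp m) := (fsval v).2.
apply: (sub_finite_set _ (finite_image F (@finite_finset _ setT))) => j /=.
rewrite -[k in _ ^+ k]card_ord -prodr_const pair_big /=.
move=> /(prod_fps_var_supp (Ordinal k_gt0, 0)) /= vm.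
by exists (FSetSub vm).
Qed.

Definition contained (la sg : intpart) : Prop :=
  forall r c, in_diagram la r c -> in_diagram sg r c.

Definition skew_boxes (la sg : intpart) : {set box sg} :=
  [set b | ~~ in_diagram la (box_row b) (box_col b)].

Definition adjacent (la : intpart) : rel (box la) := fun b b' =>
  ((box_row b == box_row b') &&
     (((box_col b).+1 == box_col b') || ((box_col b').+1 == box_col b))) ||
  ((box_col b == box_col b') &&
     (((box_row b).+1 == box_row b') || ((box_row b').+1 == box_row b))).

Definition skew_connected (la sg : intpart) : Prop :=
  {in skew_boxes la sg &, forall b b', connect
    [rel x y | [&& x \in skew_boxes la sg, y \in skew_boxes la sg & adjacent x y]] b b'}.

Definition has_square (la sg : intpart) : Prop :=
  exists r c, forall i j, (i < 2)%N -> (j < 2)%N ->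
    in_diagram sg (r + i) (c + j) && ~~ in_diagram la (r + i) (c + j).

Definition adds_border_strip (m : nat) (la sg : intpart) : Prop :=
  [/\ contained la sg, skew_connected la sg, #|skew_boxes la sg| = m
    & ~ has_square la sg].

Definition skew_rows (la sg : intpart) : {set 'I_(size sg)} :=
  [set tag b | b in skew_boxes la sg].

Definition strip_height (la sg : intpart) : nat := #|skew_rows la sg|.-1.

Lemma finite_border_strips (m : nat) (la : intpart) :
  finite_set [set sg | adds_border_strip m la sg].
Proof.
pose N := (m + size la + sumn la)%N.
pose F (t : 'I_N.+1 * N.-tuple 'I_N.+1) : seq nat :=
  [seq val i | i <- take t.1 t.2].
have finF := finite_image F (@finite_finset _ setT).
apply: (sub_finite_set _ (finite_preimage _ finF)); last first.
  by move=> sg sg' _ _; apply: val_inj.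
move=> sg [_ _ cm _].
have le_la r : (nth 0 la r <= sumn la)%N.
  elim: (parts la) r => [|x s IHs] [|r] //=; first exact: leq_addr.
  exact: leq_trans (IHs r) (leq_addl _ _).
have le_skew d (f : 'I_d -> box sg) :
    injective f -> (forall i, f i \in skew_boxes la sg) -> (d <= m)%N.
  move=> f_inj f_skew; rewrite -cm -[d]card_ord -(card_imset _ f_inj).
  by apply/subset_leq_card/fintype.subsetP => _ /imsetP[i _ ->].
have nth_sg r : (nth 0 sg r <= m + sumn la)%N.
  have [sr|rs] := leqP (size sg) r; first by rewrite nth_default.
  apply: leq_trans (leq_add (leqnn m) (le_la r)); rewrite addnC -leq_subLR.
  have lt_sg (i : 'I_(nth 0 sg r - nth 0 la r)) :
    (nth 0 la r + i < nth 0 sg r)%N by rewrite -ltn_subRL.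
  pose f i : box sg := Tagged (fun r : 'I_(size sg) => 'I_(nth 0 sg r))
    (Ordinal (lt_sg i) : 'I_(nth 0 sg (Ordinal rs))).
  apply: (le_skew _ f) => [i i' /(congr1 (@box_col sg)) /= /addnI /val_inj //|i].
  by rewrite inE /in_diagram -leqNgt leq_addr.
have size_sg : (size sg <= m + size la)%N.
  rewrite addnC -leq_subLR.
  have lt_sz (i : 'I_(size sg - size la)) : (size la + i < size sg)%N.
    by rewrite -ltn_subRL.
  have sg_gt0 (i : 'I_(size sg - size la)) : (0 < nth 0 sg (Ordinal (lt_sz i)))%N.
    case/andP: (valP sg) => _ sgN0; rewrite lt0n; apply/eqP => sg_i0.
    by have := mem_nth 0%N (lt_sz i); rewrite sg_i0 (negbTE sgN0).
  pose f i : box sg := Tagged (fun r : 'I_(size sg) => 'I_(nth 0 sg r))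
    (Ordinal (sg_gt0 i)).
  apply: (le_skew _ f) => [i i' /(congr1 (@box_row sg)) /= /addnI /val_inj //|i].
  by rewrite inE /in_diagram -leqNgt nth_default ?leq_addr.
have size_N : (size sg < N.+1)%N by rewrite ltnS (leq_trans size_sg) ?leq_addr.
have nth_N r : (nth 0 sg r < N.+1)%N.
  by rewrite ltnS (leq_trans (nth_sg r)) // leq_add2r leq_addr.
exists (Ordinal size_N, [tuple inord (nth 0 sg i) | i < N]) => //.
have size_t (t : N.-tuple 'I_N.+1) : size (take (size sg) t) = size sg.
  by rewrite size_takel // size_tuple -ltnS.
apply: (@eq_from_nth _ 0%N) => [|i]; rewrite size_map size_t // => i_sg.
have iN : (i < N)%N by apply: leq_trans i_sg _.
rewrite (nth_map ord0) ?size_t // nth_take //.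
pose t := [tuple (inord (nth 0%N sg i) : 'I_N.+1) | i < N].
have -> : nth ord0 t i = inord (nth 0%N sg i).
  rewrite -(tnth_mktuple (fun i => inord (nth 0%N sg i)) (Ordinal iN)).
  exact/esym/tnth_nth.
by rewrite /= inordK.
Qed.

(* Main.v *)
Require Import Defs.
From mathcomp Require Import all_boot all_algebra fingroup perm finmap zify.
From mathcomp Require Import boolp classical_sets functions cardinality fsbigop.
From mathcomp Require Import monalg.

Set Implicit Arguments.
Unset Strict Implicit.
Unset Printing Implicit Defensive.

Import GRing.Theory.

Local Open Scope classical_set_scope.
Local Open Scope ring_scope.

(** A partition with at most [N] rows is encoded by its beta-numbers
    [b_i = la_i + N - 1 - i], so that the box of content [c] sits at position
    [c + N - 1].  Adding a border strip of length [K] to [la] means raising one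
    beta-number by [K] and sorting again; the rows of the strip are those passed
    over, hence [(-1)^ht] is the sign of the sorting permutation.  So if [s_la]
    is the value at [b] of a function [A] that alternates in the beta-numbers,
    the right-hand side of the theorem is the sum over [i] of [A (b + K e_i)],
    where the terms with two equal beta-numbers vanish.

    Such an [A] is the Jacobi-Trudi determinant [jt].  Restrict the entries of
    tableaux to finitely many values and admit the values one after the other.
    Admitting a value adds a horizontal strip filled with it; on the
    determinant, row operations make the same horizontal strips appear
    ([det_jt_branch]), so the two agree ([tabsum_jt]).

    The identity [sum_i A (b + K e_i) = p A b] is [jt_power_sum], by induction
    on the number of values.  Only one property of the weights is used: they
    are periodic in the position with period [K].  This holds for the colored
    variables because [K = k n] is a multiple of the number of colors, and the
    product of the weights of a value over a period is then the [k]-th power of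
    the product of its [n] variables.  A run of equal new entries that ends [K]
    positions further right is either a translate of a run ending at the old
    place, which the induction hypothesis absorbs, or starts among the first
    [K] positions; the latter runs produce the power of the new value,
    provided that at least [K] rows of [la] are empty.  One takes
    [N = size la + K], which also leaves room for every border strip.

    The coefficient of a monomial only involves the values that occur in it,
    which reduces the power series identity to finitely many values. *)

(** * Determinants modified in one row or one column *)

Section Determinants.
Variables (R : comNzRingType) (N : nat).
Implicit Types (A B : 'M[R]_N).

Definition set_row A B (i : 'I_N) : 'M[R]_N :=
  \matrix_(r, c) (if r == i then B else A) r c.

Definition set_col A B (j : 'I_N) : 'M[R]_N :=
  \matrix_(r, c) (if c == j then B else A) r c.

(** Both sides are the derivative at [t = 0] of [\det (A + t B)], that is, the
    sum of the [B i j] times the cofactors of [A]. *)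
Lemma sum_det_set_row A B :
  \sum_i \det (set_row A B i) = \sum_j \det (set_col A B j).
Proof.
pose D := \sum_i \sum_j B i j * cofactor A i j.
have -> : \sum_i \det (set_row A B i) = D.
  apply: eq_bigr => i _; rewrite (expand_det_row _ i); apply: eq_bigr => j _.
  rewrite mxE eqxx; congr (_ * (_ * \det _)); apply/matrixP => r c.
  by rewrite !mxE eq_sym (negbTE (neq_lift _ _)).
rewrite /D exchange_big /=; apply: eq_bigr => j _; rewrite (expand_det_col _ j).
apply: eq_bigr => i _; rewrite mxE eqxx.
congr (_ * (_ * \det _)); apply/matrixP => r c.
by rewrite !mxE [lift j c == j]eq_sym (negbTE (neq_lift _ _)).
Qed.

Lemma det_zero_row A i : (forall j, A i j = 0) -> \det A = 0.
Proof. by move=> A0; rewrite (expand_det_row _ i) big1 // => j _; rewrite A0 mul0r. Qed.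

Lemma det_eq_cols A j1 j2 :
  j1 != j2 -> (forall i, A i j1 = A i j2) -> \det A = 0.
Proof.
move=> j12 A12; rewrite -det_tr; apply: (determinant_alternate j12) => i.
by rewrite !mxE A12.
Qed.

(** Multilinearity in the rows, as in the first half of a proof of the
    Cauchy-Binet formula.  The family [Y] may depend on the row, so that the
    expansion also applies to a matrix in which one row has been modified. *)
Lemma det_sum_rows (B : nat) (X : 'I_N -> 'I_B -> R) (Y : 'I_N -> 'I_B -> 'I_N -> R) :
  \det (\matrix_(i, j) \sum_(c < B) X i c * Y i c j) =
  \sum_(f : {ffun 'I_N -> 'I_B})
     (\prod_i X i (f i)) * \det (\matrix_(i, j) Y i (f i) j).
Proof.
rewrite /determinant.
under eq_bigr => s _.
  under eq_bigr => i _ do rewrite mxE.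
  rewrite bigA_distr_bigA mulr_sumr; over.
rewrite exchange_big; apply: eq_bigr => f _; rewrite mulr_sumr.
apply: eq_bigr => s _; rewrite big_split /= mulrCA; congr (_ * (_ * _)).
by apply: eq_bigr => i _; rewrite mxE.
Qed.

(** Replacing row [i] by a multiple of row [i1] repeats row [i1], unless
    [i = i1].  The factor is given as a family [u] over all rows to match the
    shape of [set_row]. *)
Lemma det_set_row_scale A (u : 'I_N -> R) (i i1 : 'I_N) :
  \det (set_row A (\matrix_(r, c) (u r * A i1 c)) i) =
  if i == i1 then u i1 * \det A else 0.
Proof.
have -> : set_row A (\matrix_(r, c) (u r * A i1 c)) i
  = \matrix_(r, c) (if r == i then u i * A i1 c else A r c).
  by apply/matrixP => r c; rewrite !mxE; case: eqP => [->|]; rewrite ?mxE.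
rewrite (expand_det_row _ i).
under eq_bigr => j _ do rewrite mxE eqxx -mulrA.
rewrite -mulr_sumr.
set C := (X in cofactor X).
have -> : \sum_j A i1 j * cofactor C i j = \det (set_row A (\matrix_(r, c) A i1 c) i).
  rewrite (expand_det_row _ i); apply: eq_bigr => j _.
  rewrite !mxE eqxx !mxE; congr (_ * (_ * \det _)); apply/matrixP => r c.
  by rewrite !mxE [lift i r == i]eq_sym (negbTE (neq_lift _ _)).
case: eqP => [->|/eqP ii1].
  congr (_ * \det _); apply/matrixP => r c; rewrite !mxE.
  by case: eqP => [->|]; rewrite ?mxE.
rewrite (determinant_alternate ii1) ?mulr0 // => j; rewrite !mxE eqxx.
by rewrite eq_sym (negbTE ii1) mxE.
Qed.

End Determinants.

(** * Jacobi-Trudi determinants and power sums *)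

Section JacobiTrudi.
Variables (R : comNzRingType) (z : nat -> nat -> R).

(** The value [M], placed at position [p], weighs [z M p].  A run of [M]s fills
    the positions [c, ..., q - 1]; the value is 0, not an empty product, if
    [q < c]. *)
Definition run_weight M q c : R := if (c <= q)%N then \prod_(c <= p < q) z M p else 0.

(** The loop version of a complete homogeneous function: the sum over all
    weakly increasing fillings of the positions [a, ..., q - 1] with values
    less than [M], split according to the final run of the largest value. *)
Fixpoint complete M q a : R :=
  if M is M'.+1 then \sum_(c < q.+1) run_weight M' q c * complete M' c a else (q == a)%:R.

Lemma completeS B M q a : (q < B)%N ->
  complete M.+1 q a = \sum_(c < B) run_weight M q c * complete M c a.
Proof.
move=> qB.
rewrite /= (big_ord_widen B (fun c => run_weight M q c * complete M c a)) //.
rewrite big_mkcond.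
by apply: eq_bigr => c _; rewrite ltnS /run_weight; case: (c <= q)%N; rewrite ?mul0r.
Qed.

Lemma run_weightS M q c : (c <= q)%N -> run_weight M q.+1 c = z M q * run_weight M q c.
Proof. by move=> cq; rewrite /run_weight (leqW cq) cq big_nat_recr //= mulrC. Qed.

Lemma run_weight_trans M q p c : (c <= p)%N -> (p <= q)%N ->
  run_weight M q c = run_weight M q p * run_weight M p c.
Proof.
move=> cp pq; rewrite /run_weight cp pq (leq_trans cp pq) mulrC.
by rewrite (big_cat_nat cp pq).
Qed.

(** The columns stand for [N - 1, ..., 0], the beta-numbers of the empty
    partition; without values the determinant is thus 1 for the empty
    partition and 0 for all others. *)
Definition jt N M (b : 'I_N -> nat) : 'M[R]_N :=
  \matrix_(i, j) complete M (b i) (rev_ord j).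

Definition bump_at N K (b : 'I_N -> nat) (i : 'I_N) : 'I_N -> nat :=
  fun l => (b l + K * (l == i))%N.

Lemma jt_bump N M K (b : 'I_N -> nat) i :
  jt M (bump_at K b i) = set_row (jt M b) (jt M (fun l => b l + K)%N) i.
Proof.
apply/matrixP => r c; rewrite !mxE /bump_at.
by case: eqP => _; rewrite mxE ?muln1 ?muln0 ?addn0.
Qed.

(** The sum over the raised beta-numbers alternates in [b] although its terms
    do not: rewritten as a sum over modified columns, each matrix keeps the
    equal rows [i1] and [i2]. *)
Lemma sum_jt_bump_alt N M K (b : 'I_N -> nat) (i1 i2 : 'I_N) :
  i1 != i2 -> b i1 = b i2 -> \sum_i \det (jt M (bump_at K b i)) = 0.
Proof.
move=> i12 b12.
under eq_bigr => i _ do rewrite jt_bump.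
rewrite sum_det_set_row big1 // => j _.
by apply: (determinant_alternate i12) => c; rewrite !mxE; case: eqP; rewrite !mxE b12.
Qed.

Variables (K : nat) (K_gt0 : (0 < K)%N).
Hypothesis zK : forall M p, z M (p + K)%N = z M p.

Lemma run_weightDK M q c : run_weight M (q + K)%N (c + K)%N = run_weight M q c.
Proof.
rewrite /run_weight leq_add2r; case: ifP => // _.
by rewrite big_addn addnK; apply: eq_bigr => p _; rewrite zK.
Qed.

(** A run ending at [q + K] and starting at [K] or later is the translate of a
    run ending at [q].  A run starting before [K] passes the positions
    [K - 1] and [K]: from [K] on it is the translate of the run from 0 to [q],
    it then weighs [z M K.-1] at position [K - 1], and what remains is counted
    by the function at [K - 1]. *)
Lemma completeDK M q a B : (q < B)%N ->
  complete M.+1 (q + K)%N a =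
  run_weight M q 0 * (z M K.-1 * complete M.+1 K.-1 a) +
  \sum_(c < B) run_weight M q c * complete M (c + K)%N a.
Proof.
move=> qB; have kk : (q + K < K + B)%N by rewrite addnC ltn_add2l.
rewrite (completeS _ _ kk) big_split_ord; congr (_ + _); last first.
  by apply: eq_bigr => c _ /=; rewrite [(K + c)%N]addnC run_weightDK.
have KE := prednK K_gt0; rewrite (@completeS K) ?KE // !mulr_sumr.
apply: eq_bigr => c _ /=; have cK : (c <= K.-1)%N by rewrite -ltnS KE.
rewrite (@run_weight_trans _ (q + K)%N K c) ?leq_addl //; last exact: ltnW.
rewrite -[X in run_weight M (q + K)%N X]add0n run_weightDK.
by rewrite -[X in run_weight M X c]KE run_weightS // !mulrA.
Qed.

(** For the beta-numbers of a partition, this says that at least [K] of the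
    [N] rows are empty. *)
Definition covers N (b : 'I_N -> nat) := forall q, (q < K)%N -> exists i, b i = q.

(** Distinct beta-numbers that fill the bottom positions cannot move down
    without colliding, so they stay. *)
Lemma covers_le N (b d : 'I_N -> nat) :
  covers b -> injective d -> (forall i, d i <= b i)%N -> covers d.
Proof.
move=> cb dinj db; suff dE q i : (q < K)%N -> b i = q -> d i = q.
  by move=> q qK; have [i bi] := cb q qK; exists i; apply: dE.
elim/ltn_ind: q i => q IH i qK bi.
have := db i; rewrite bi leq_eqVlt => /orP[/eqP //|diq].
have [l bl] := cb _ (ltn_trans diq qK).
have /dinj li := IH _ diq l (ltn_trans diq qK) bl.
by move: diq; rewrite -bl li bi ltnn.
Qed.

(** Induction on [M].  By [completeDK] the row raised by [K] is the sum of two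
    rows.  The first is a multiple of the row with beta-number [K - 1], so it
    contributes for that row only, and gives the product of the [z M p] over
    [p < K].  The second has the form of the original row with the positions
    inside raised by [K]; expanding by [det_sum_rows] leads to the induction
    hypothesis at the configurations [f] below [b]. *)
Lemma jt_power_sum N M (b : 'I_N -> nat) : covers b ->
  \sum_i \det (jt M (bump_at K b i)) =
  (\sum_(v < M) \prod_(0 <= p < K) z v p) * \det (jt M b).
Proof.
elim: M b => [|M IH] b cb.
  rewrite big_ord0 mul0r.
  under eq_bigr => i _ do rewrite jt_bump.
  (* Without values, column [j] becomes column [j + K], or 0 if the position
     that it stands for is less than [K]. *)
  rewrite sum_det_set_row big1 // => j _.
  have [Kj|jK] := leqP K (rev_ord j).
    have jKN : (j + K < N)%N by move: Kj; rewrite /=; lia.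
    apply: (@det_eq_cols _ _ _ j (Ordinal jKN)).
      by apply/eqP => /(congr1 val) /=; lia.
    move=> i; rewrite !mxE eqxx !mxE /=; case: ifP.
      by move=> /eqP /(congr1 val) /=; lia.
    by rewrite !mxE /= => _; congr (_%:R); move: Kj => /=; lia.
  rewrite (expand_det_col _ j) big1 // => i _; rewrite !mxE eqxx !mxE /=.
  suff -> : (b i + K == N - j.+1)%N = false by rewrite mul0r.
  by move: jK => /=; lia.
have [i1 bi1] : exists i, b i = K.-1 by apply: cb; rewrite prednK.
pose B := (\max_i b i).+1.
have bB i : (b i < B)%N by rewrite ltnS (leq_bigmax (F := b)).
pose A := jt M.+1 b.
pose C1 := \matrix_(r, c) ((run_weight M (b r) 0 * z M K.-1) * A i1 c).
pose C2 := \matrix_(r < N, c < N)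
  \sum_(d < B) run_weight M (b r) d * complete M (d + K)%N (rev_ord c).
have bumpE i : \det (jt M.+1 (bump_at K b i)) =
    \det (set_row A C1 i) + \det (set_row A C2 i).
  rewrite jt_bump -/A -[RHS]mul1r -[1 * _]addr0.
  rewrite (@determinant_multilinear _ _ _ (set_row A C1 i) (set_row A C2 i) i 1 1).
  - by rewrite !mul1r addr0.
  - by apply/rowP => c; rewrite !mxE eqxx !mxE !mul1r bi1 -mulrA (completeDK _ _ (bB i)).
  - by apply/matrixP => r c; rewrite !mxE eq_sym (negbTE (neq_lift _ _)).
  - by apply/matrixP => r c; rewrite !mxE eq_sym (negbTE (neq_lift _ _)).
under eq_bigr => i _ do rewrite bumpE.
rewrite big_split /= big_ord_recr /= mulrDl addrC; congr (_ + _); last first.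
  under eq_bigr => i _ do rewrite det_set_row_scale.
  rewrite (bigD1 i1) //= eqxx big1 ?addr0; last by move=> i /negbTE ->.
  congr (_ * _); rewrite bi1 mulrC -run_weightS // prednK //.
have AE : A = \matrix_(i, j) \sum_(c < B) run_weight M (b i) c * complete M c (rev_ord j).
  by apply/matrixP => i j; rewrite !mxE; apply: completeS.
have set2 i : \det (set_row A C2 i) = \sum_(f : {ffun 'I_N -> 'I_B})
    (\prod_l run_weight M (b l) (f l)) * \det (jt M (bump_at K (fun l => f l) i)).
  pose Y l (c : 'I_B) j := complete M (c + K * (l == i))%N (@rev_ord N j).
  transitivity (\sum_(f : {ffun 'I_N -> 'I_B})
    (\prod_l run_weight M (b l) (f l)) * \det (\matrix_(l, j) Y l (f l) j)).
    rewrite -(det_sum_rows (fun l (c : 'I_B) => run_weight M (b l) c)).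
    congr (\det _); apply/matrixP => l j.
    rewrite !mxE AE; case: eqP => [->|li]; rewrite !mxE; apply: eq_bigr => c _.
      by rewrite /Y eqxx muln1.
    by rewrite /Y; case: eqP => // _; rewrite muln0 addn0.
  by apply: eq_bigr => f _; congr (_ * \det _).
under eq_bigr => i _ do rewrite set2.
rewrite exchange_big /= -/A AE (det_sum_rows (fun l (c : 'I_B) => run_weight M (b l) c)
  (fun l (c : 'I_B) (j : 'I_N) => complete M c (rev_ord j))) mulr_sumr; apply: eq_bigr => f _.
rewrite -mulr_sumr mulrCA.
have [/forallP fb|] := boolP [forall l, f l <= b l]%N; last first.
  rewrite negb_forall => /existsP[l fl].
  suff -> : \prod_l0 run_weight M (b l0) (f l0) = 0 by rewrite !mul0r.
  by rewrite (bigD1 l) //= /run_weight (negbTE fl) mul0r.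
(* If [f] takes a value twice, it may fail to cover the bottom positions, but
   then both sides vanish. *)
congr (_ * _); have [/injectiveP finj|] := boolP (injectiveb f).
  rewrite IH //; apply: (@covers_le _ b) => //.
  by move=> x y /val_inj /finj.
move=> /injectivePn[l1 [l2 l12 f12]].
rewrite (@sum_jt_bump_alt _ _ _ _ l1 l2) //; last by rewrite f12.
rewrite (determinant_alternate l12) ?mulr0 // => j; by rewrite !mxE f12.
Qed.

End JacobiTrudi.

(** * Branching of the determinant *)

Lemma big_nat_ord (R : Type) (idx : R) (op : Monoid.law idx) m n B (F : nat -> R) :
  (n <= B)%N ->
  \big[op/idx]_(m <= i < n) F i =
  \big[op/idx]_(i < B) if (m <= i < n)%N then F i else idx.
Proof.
move=> nB; rewrite (@big_nat_widenl _ _ _ m 0) // (@big_nat_widen _ _ _ 0 n B) //.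
by rewrite big_mkord big_mkcond.
Qed.

Arguments complete : simpl never.

Section Shapes.
Local Open Scope nat_scope.

Definition shape (N : nat) (f : nat -> nat) :=
  (forall r, f r.+1 <= f r) /\ f N = 0.

Lemma shape_homo N f r s : shape N f -> r <= s -> f s <= f r.
Proof.
move=> [f_dec _] rs; rewrite -(subnK rs).
by elim: (s - r) => // k; apply: leq_trans; exact: f_dec.
Qed.

Lemma shape_lt N B f r : shape N f -> f 0 < B -> f r < B.
Proof. by move=> fs; apply: leq_ltn_trans; apply: shape_homo fs _. Qed.

(** The position just after the last box of row [i]: the box [(r, c)] has
    position [c + (N - r.+1)], which is its content plus [N - 1]. *)
Definition beta N (f : nat -> nat) (i : 'I_N) := f i + (N - i.+1).

End Shapes.

Section Branching.
Variables (R : comNzRingType) (z : nat -> nat -> R).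

(** The contribution of row [r] when a horizontal strip filled with [M] is
    added to a shape with rows [g] to obtain [f]: the boxes [g r, ..., f r - 1]
    are new, and none of them may lie above a box of row [r + 1] of [f]. *)
Definition interlace_weight N M (f : nat -> nat) (r g : nat) : R :=
  if (f r.+1 <= g <= f r)%N then \prod_(g <= c < f r) z M (c + (N - r.+1))%N else 0.

(** A run starting at [p] or before factors through [p]. *)
Lemma complete_sub M q p a : (p < q)%N ->
  complete z M.+1 q a - run_weight z M q p * complete z M.+1 p a =
  \sum_(p.+1 <= c < q.+1) run_weight z M q c * complete z M c a.
Proof.
move=> pq; apply/eqP; rewrite subr_eq; apply/eqP.
rewrite /complete -/complete.
rewrite -!(big_mkord xpredT (fun c => run_weight z M _ c * complete z M c a)).
rewrite (@big_cat_nat _ _ _ p.+1) //=; last exact: ltnW.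
rewrite addrC; congr (_ + _); rewrite mulr_sumr big_nat [RHS]big_nat.
apply: eq_bigr => c /andP[_ cp].
by rewrite mulrA -run_weight_trans // ltnW.
Qed.

(** Subtracting the right multiple of row [i + 1] from row [i] of the
    determinant removes the runs that start at or before the beta-number of
    row [i + 1]; those that remain are the admissible parts of a horizontal
    strip.  The last row is left as it is: there [f i.+1 = f N = 0] is no
    constraint. *)
Lemma complete_beta_sum N M B f (i : 'I_N) a : shape N f -> (f 0 < B)%N ->
  \sum_(g < B) interlace_weight N M f i g * complete z M (g + (N - i.+1))%N a =
  complete z M.+1 (beta f i) a -
  (if (i.+1 < N)%N then
     run_weight z M (beta f i) (f i.+1 + (N - i.+2))%N
       * complete z M.+1 (f i.+1 + (N - i.+2))%N a
   else 0).
Proof.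
move=> fs f0B; have [f_dec fN] := fs; have fB r := shape_lt r fs f0B.
have -> : \sum_(g < B) interlace_weight N M f i g * complete z M (g + (N - i.+1))%N a =
   \sum_(f i.+1 + (N - i.+1) <= c < (beta f i).+1)
      run_weight z M (beta f i) c * complete z M c a.
  rewrite big_addn -addSn addnK (@big_nat_ord _ _ _ _ _ B) //; apply: eq_bigr => g _.
  rewrite /interlace_weight ltnS; case: ifP => [/andP[_ gf]|]; last by rewrite mul0r.
  by rewrite /run_weight leq_add2r gf big_addn -addnBA // subnn addn0.
case: ifP => iN.
  rewrite complete_sub; last by rewrite /beta; have := f_dec i; lia.
  by rewrite -addnS; congr (\sum_(_ + _ <= _ < _) _); lia.
have iE : i.+1 = N by apply/eqP; rewrite eqn_leq ltn_ord leqNgt iN.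
by rewrite subr0 iE subnn addn0 fN big_mkord.
Qed.

Lemma det_jt_branch N M B f : shape N f -> (f 0 < B)%N ->
  \det (jt z M.+1 (@beta N f)) =
  \sum_(g : {ffun 'I_N -> 'I_B})
     (\prod_(r < N) interlace_weight N M f r (g r)) *
     \det (jt z M (fun r : 'I_N => g r + (N - r.+1))%N).
Proof.
move=> fs f0B.
(* The row operations of [complete_beta_sum], as a unitriangular matrix. *)
pose L : 'M[R]_N := \matrix_(i, j) ((i == j)%:R -
  (if j == i.+1 :> nat then run_weight z M (beta f i) (beta f j) else 0)).
have detL : \det L = 1.
  rewrite -det_tr det_trig.
    by rewrite big1 // => i _; rewrite !mxE eqxx (ltn_eqF (ltnSn i)) subr0.
  apply/is_trig_mxP => i j ij; rewrite !mxE -val_eqE /= (gtn_eqF ij).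
  by rewrite (ltn_eqF (ltnW _)) ?subr0 // ltnS.
rewrite -[LHS]mul1r -[X in X * _ = _]detL -det_mulmx.
apply: etrans (det_sum_rows (fun (r : 'I_N) (c : 'I_B) => interlace_weight N M f r c)
   (fun (r : 'I_N) (c : 'I_B) (j : 'I_N) => complete z M (c + (N - r.+1))%N (rev_ord j))).
congr (\det _); apply/matrixP => i j; rewrite !mxE (complete_beta_sum _ _ _ fs f0B).
under eq_bigr => k _ do rewrite !mxE mulrBl.
rewrite sumrB; congr (_ - _).
  rewrite (bigD1 i) //= eqxx mul1r [X in _ + X]big1 ?addr0 // => k.
  by rewrite eq_sym => /negbTE ->; rewrite mul0r.
case: ifP => iN; last first.
  rewrite big1 // => k _; case: eqP => [kE|]; rewrite ?mul0r //.
  by rewrite -kE ltn_ord in iN.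
rewrite (bigD1 (Ordinal iN)) //= eqxx [X in _ + X]big1 ?addr0 // => k.
by rewrite -val_eqE => /negbTE /= ->; rewrite mul0r.
Qed.

End Branching.

(** * Tableaux, one value at a time *)

Section Tableaux.
Variables (R : comNzRingType) (z : nat -> nat -> R) (N B E : nat).
Notation grid := ('I_N * 'I_B.+1)%type.
Notation filling := {ffun grid -> 'I_E.+1}.
Implicit Types (f : nat -> nat) (T : filling) (g : {ffun 'I_N -> 'I_B.+1}).

(** Tableaux of all shapes are fillings of one rectangle, which holds 0 outside
    the shape; a tableau thus corresponds to exactly one filling, and the shape
    can vary without changing the type.  Entries are counted from 0. *)
Record tableau_spec M f T : Prop := TableauSpec {
  tab_lt : forall (r : 'I_N) (c : 'I_B.+1), (c < f r)%N -> (T (r, c) < M)%N;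
  tab_off : forall (r : 'I_N) (c : 'I_B.+1), (f r <= c)%N -> T (r, c) = ord0;
  tab_row : forall (r : 'I_N) (c c' : 'I_B.+1),
    (c <= c')%N -> (c' < f r)%N -> (T (r, c) <= T (r, c'))%N;
  tab_col : forall (r r' : 'I_N) (c : 'I_B.+1),
    (r < r')%N -> (c < f r')%N -> (T (r, c) < T (r', c))%N }.

Definition tableau M f T : bool := `[< tableau_spec M f T >].

Definition weight f T : R :=
  \prod_(p : grid) if (p.2 < f p.1)%N then z (T p) (p.2 + (N - p.1.+1))%N else 1.

Definition tabsum M f : R := \sum_(T | tableau M f T) weight f T.

Definition extend g (r : nat) : nat := if insub r is Some i then g i else 0%N.

Lemma extendE g (r : 'I_N) : extend g r = g r.
Proof. by rewrite /extend valK. Qed.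

Lemma tabsum0 f : shape N f -> (f 0 < B.+1)%N -> tabsum 0 f = (f 0 == 0)%N%:R.
Proof.
move=> fs f0B; have [f0|f0] := posnP (f 0%N); last first.
  rewrite /tabsum big_pred0 // => T; apply/asboolP => -[lt0 _ _ _].
  have N0 : (0 < N)%N.
    by case: (N) fs => // -[_ f00]; rewrite f00 in f0.
  by have := lt0 (Ordinal N0) ord0 f0.
have fr r : f r = 0%N by apply/eqP; rewrite -leqn0 -f0; apply: (shape_homo fs).
rewrite /tabsum (big_pred1 [ffun => ord0]).
  by rewrite /weight big1 // => p _; rewrite fr.
move=> T; apply/asboolP/eqP => [[_ off _ _]|->].
  by apply/ffunP => -[r c]; rewrite ffunE off ?fr.
by split=> [r c|r c|r c c'|r r' c]; rewrite ?fr ?ffunE.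
Qed.

(** As rows increase weakly, the entries less than [M] are initial segments of
    the rows; they end at the first entry that is at least [M]. *)
Definition inner_rows M f T : {ffun 'I_N -> 'I_B.+1} :=
  [ffun r : 'I_N => inord (find (fun c => (M <= T (r, inord c))%N) (iota 0 (f r)))].

Definition interlaced f g := [forall r : 'I_N, (f r.+1 <= g r <= f r)%N].

Lemma innerE M f T (r : 'I_N) : shape N f -> (f 0 < B.+1)%N ->
  inner_rows M f T r = find (fun c => (M <= T (r, inord c))%N) (iota 0 (f r)) :> nat.
Proof.
move=> fs f0B; rewrite ffunE inordK //; apply: leq_ltn_trans (shape_lt r fs f0B).
by apply: leq_trans (find_size _ _) _; rewrite size_iota.
Qed.

Lemma inner_le M f T (r : 'I_N) : shape N f -> (f 0 < B.+1)%N ->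
  (inner_rows M f T r <= f r)%N.
Proof.
move=> fs f0B; rewrite innerE //.
by apply: leq_trans (find_size _ _) _; rewrite size_iota.
Qed.

Lemma lt_inner M f T (r : 'I_N) (c : 'I_B.+1) : shape N f -> (f 0 < B.+1)%N ->
  tableau_spec M.+1 f T -> (c < f r)%N -> (c < inner_rows M f T r)%N = (T (r, c) < M)%N.
Proof.
move=> fs f0B [_ _ row _] cf; have := inner_le M T r fs f0B.
rewrite innerE // => kf; have [ck|kc] := ltnP.
  have := before_find 0%N ck; rewrite nth_iota // add0n inord_val => /negbT.
  by rewrite -ltnNge => ->.
apply/esym/negbTE; rewrite -leqNgt.
have kf' := leq_ltn_trans kc cf.
have := @nth_find _ 0%N (fun c => (M <= T (r, inord c))%N) (iota 0 (f r)).
rewrite has_find size_iota => /(_ kf'); rewrite nth_iota // add0n => /leq_trans; apply.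
by apply: row => //; rewrite inordK // (ltn_trans kf') // (shape_lt r fs f0B).
Qed.

(** If row [r + 1] has a box below an entry of row [r] that is at least [M],
    then this box has an entry greater than [M]. *)
Lemma interlaced_inner M f T : shape N f -> (f 0 < B.+1)%N ->
  tableau_spec M.+1 f T -> interlaced f (inner_rows M f T).
Proof.
move=> fs f0B tT; apply/forallP => r; rewrite inner_le // andbT leqNgt.
apply/negP => k_lt.
have kf : (inner_rows M f T r < f r)%N := leq_trans k_lt (proj1 fs r).
have := lt_inner fs f0B tT kf; rewrite ltnn => /esym/negbT; rewrite -leqNgt => MT.
have rN : (r.+1 < N)%N.
  rewrite ltn_neqAle ltn_ord andbT; apply/eqP => rN.
  by move: k_lt; rewrite rN (proj2 fs).
have := tab_col tT (r := r) (r' := Ordinal rN) (ltnSn r) k_lt.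
have := tab_lt tT (r := Ordinal rN) k_lt.
by move: MT; lia.
Qed.

Variable M : nat.
Hypothesis ME : (M <= E)%N.

Definition fill f g T : filling :=
  [ffun p : grid => if (g p.1 <= p.2 < f p.1)%N then inord M else T p].
Definition cut g T : filling := [ffun p : grid => if (p.2 < g p.1)%N then T p else ord0].

Lemma inordM : @inord E M = M :> nat.
Proof. by rewrite inordK. Qed.

Lemma fill_cut f T : shape N f -> (f 0 < B.+1)%N -> tableau_spec M.+1 f T ->
  fill f (inner_rows M f T) (cut (inner_rows M f T) T) = T.
Proof.
move=> fs f0B tT; have := fun r c => lt_inner (r := r) (c := c) fs f0B tT.
move: (inner_rows M f T) => k ltk; apply/ffunP => -[r c]; rewrite !ffunE /=.
have [cf|fc] := ltnP c (f r); last first.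
  by rewrite andbF (tab_off tT fc) if_same.
rewrite andbT leqNgt ltk //; case: ltnP => //= MT.
apply: val_inj; rewrite /= inordM; apply/eqP.
by rewrite eqn_leq MT -ltnS (tab_lt tT).
Qed.

(** For interlaced shapes, [fill] and [cut] are inverse bijections between the
    tableaux of the smaller shape with values less than [M] and the tableaux of
    shape [f] with values at most [M] whose entries less than [M] occupy [g].
    The statement has the form that [reindex_onto] asks for. *)
Lemma fill_tableau f g T : shape N f -> (f 0 < B.+1)%N -> interlaced f g ->
  [&& tableau M.+1 f (fill f g T), inner_rows M f (fill f g T) == g & cut g (fill f g T) == T]
  = tableau M (extend g) T.
Proof.
move=> fs f0B /forallP gf.
have gle r : (g r <= f r)%N by have /andP[] := gf r.
have gcol (r r' : 'I_N) : (r < r')%N -> (f r' <= g r)%N.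
  by move=> rr'; have /andP[/(leq_trans _) + _] := gf r; apply; apply: shape_homo fs _.
have fillin r (c : 'I_B.+1) : (c < g r)%N -> fill f g T (r, c) = T (r, c).
  by move=> cg; rewrite ffunE /= leqNgt cg.
have fillM r (c : 'I_B.+1) : (g r <= c)%N -> (c < f r)%N -> fill f g T (r, c) = M :> nat.
  by move=> gc cf; rewrite ffunE /= gc cf inordM.
apply/and3P/asboolP => [[/asboolP tT /eqP kg /eqP cT]|tT].
  have lt_g r (c : 'I_B.+1) : (c < g r)%N -> (T (r, c) < M)%N.
    move=> cg; have cf := leq_trans cg (gle r).
    by rewrite -fillin // -(lt_inner fs f0B tT cf) kg.
  split=> [r c|r c|r c c'|r r' c]; rewrite ?extendE.
  - exact: lt_g.
  - by move=> gc; rewrite -cT ffunE /= ltnNge gc.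
  - move=> cc' cg'; have cg := leq_ltn_trans cc' cg'.
    by rewrite -!fillin //; apply: (tab_row tT) => //; apply: leq_trans cg' (gle r).
  - move=> rr' cg'; have cf' := leq_trans cg' (gle r').
    rewrite -!fillin //; first by apply: (tab_col tT).
    exact: leq_trans cf' (gcol _ _ rr').
have lt_g r (c : 'I_B.+1) : (c < g r)%N -> (T (r, c) < M)%N.
  by move=> cg; apply: (tab_lt tT); rewrite extendE.
have off_g r (c : 'I_B.+1) : (g r <= c)%N -> T (r, c) = ord0.
  by move=> cg; apply: (tab_off tT); rewrite extendE.
have tF : tableau_spec M.+1 f (fill f g T).
  split=> [r c|r c|r c c'|r r' c].
  - move=> cf; have [cg|gc] := ltnP c (g r); last by rewrite fillM.
    by rewrite fillin // ltnS ltnW // lt_g.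
  - move=> fc; rewrite ffunE /= [(c < f r)%N]ltnNge fc andbF off_g //.
    exact: leq_trans (gle r) fc.
  - move=> cc' cf'; have [cg'|gc'] := ltnP c' (g r); last first.
      rewrite (fillM _ _ gc') //; have [cg|gc] := ltnP c (g r).
        by rewrite fillin // ltnW // lt_g.
      by rewrite fillM // (leq_ltn_trans cc').
    rewrite !fillin //; last exact: leq_ltn_trans cc' cg'.
    by apply: (tab_row tT) => //; rewrite extendE.
  - move=> rr' cf'; have cg := leq_trans cf' (gcol _ _ rr').
    rewrite fillin //; have [cg'|gc'] := ltnP c (g r').
      by rewrite fillin //; apply: (tab_col tT) => //; rewrite extendE.
    by rewrite (fillM _ _ gc') // lt_g.
split; first exact/asboolP.
  apply/eqP/ffunP => r; apply/val_inj/eqP => /=.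
  rewrite eqn_leq; apply/andP; split; rewrite leqNgt; apply/negP => lt.
    have gf' := leq_trans lt (inner_le M _ r fs f0B).
    by move: lt; rewrite lt_inner // fillM // ltnn.
  have kf := leq_trans lt (gle r).
  have := lt_inner fs f0B tF kf; rewrite ltnn fillin // => /esym/negbT.
  by rewrite lt_g.
apply/eqP/ffunP => -[r c]; rewrite ffunE /=; case: ltnP => cg; last by rewrite off_g.
by rewrite fillin.
Qed.

Lemma weight_fill f g T : shape N f -> (f 0 < B.+1)%N -> interlaced f g ->
  weight f (fill f g T) =
  (\prod_(r < N) interlace_weight z N M f r (g r)) * weight (extend g) T.
Proof.
move=> fs f0B /forallP gf.
have -> : \prod_(r < N) interlace_weight z N M f r (g r) =
   \prod_(p : grid) if (g p.1 <= p.2 < f p.1)%N then z M (p.2 + (N - p.1.+1))%N else 1.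
  rewrite -(pair_bigA _ (fun (r : 'I_N) (c : 'I_B.+1) =>
    if (g r <= c < f r)%N then z M (c + (N - r.+1))%N else 1)).
  apply: eq_bigr => r _; rewrite /interlace_weight gf (@big_nat_ord _ _ _ _ _ B.+1) //.
  exact: ltnW (shape_lt r fs f0B).
rewrite -big_split; apply: eq_bigr => -[r c] _ /=; rewrite extendE ffunE /=.
have /andP[_ gle] := gf r.
have [cg|gc] /= := ltnP c (g r); first by rewrite (leq_trans cg gle) mul1r.
by case: ifP => [->|]; rewrite ?inordM ?mulr1.
Qed.

Lemma tabsum_branch f : shape N f -> (f 0 < B.+1)%N ->
  tabsum M.+1 f =
  \sum_(g : {ffun 'I_N -> 'I_B.+1})
     (\prod_(r < N) interlace_weight z N M f r (g r)) * tabsum M (extend g).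
Proof.
move=> fs f0B; rewrite /tabsum (partition_big (inner_rows M f) xpredT) //=.
apply: eq_bigr => g _; have [fg|] := boolP (interlaced f g); last first.
  move=> fg; rewrite big_pred0 => [|T]; last first.
    apply/negbTE/negP => /andP[/asboolP tT /eqP gE].
    by move: fg; rewrite -gE interlaced_inner.
  move: fg; rewrite negb_forall => /existsP[r /negbTE fr].
  by rewrite (bigD1 r) //= /interlace_weight fr !mul0r.
rewrite (reindex_onto (fill f g) (cut g)) => [|T /andP[/asboolP tT /eqP <-]]; last first.
  exact: fill_cut.
rewrite mulr_sumr; apply: eq_big => [T|T _].
  by rewrite -andbA fill_tableau.
exact: weight_fill.
Qed.

End Tableaux.

(** By [tabsum_branch] and [det_jt_branch] both sides obey the same recursion
    in the number of values. *)
Theorem tabsum_jt (R : comNzRingType) (z : nat -> nat -> R) N B E M f :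
  shape N f -> (f 0 < B.+1)%N -> (M <= E)%N ->
  tabsum z N B E M f = \det (jt z M (@beta N f)).
Proof.
elim: M f => [|M IH] f fs f0B ME.
  rewrite tabsum0 //; have [f0|f0] := posnP (f 0%N).
    have -> : jt z 0 (@beta N f) = 1%:M; last by rewrite det1.
    apply/matrixP => i j; rewrite !mxE /complete /beta /= -val_eqE /=; congr (_%:R).
    have := shape_homo fs (leq0n i); rewrite f0 leqn0 => /eqP ->.
    by congr nat_of_bool; have := ltn_ord i; have := ltn_ord j; lia.
  have N0 : (0 < N)%N.
    by case: (N) fs => // -[_ f00]; rewrite f00 in f0.
  rewrite (det_zero_row (i := Ordinal N0)) // => j; rewrite !mxE /complete /beta /=.
  by case: eqP => //; lia.
rewrite tabsum_branch ?(ltnW ME) // (det_jt_branch _ _ fs f0B).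
apply: eq_bigr => g _.
have [/forallP fg|] := boolP (interlaced f g); last first.
  rewrite negb_forall => /existsP[r /negbTE fr].
  by rewrite (bigD1 r) //= /interlace_weight fr !mul0r.
congr (_ * _); rewrite IH ?(ltnW ME) //.
- by congr (\det _); apply/matrixP => i j; rewrite !mxE /beta extendE.
- split=> [r|]; last by rewrite /extend insubF ?ltnn.
  have [rN|Nr] := ltnP r.+1 N; last by rewrite {1}/extend insubF ?(ltnNge r.+1) ?Nr.
  have /andP[_] := fg (Ordinal rN); have /andP[+ _] := fg (Ordinal (ltnW rN)).
  rewrite -!extendE /= => a b; exact: leq_trans b a.
- by rewrite /extend; case: insub.
Qed.

(** * Border strips as moves of one beta-number *)

Section Strips.
Local Open Scope nat_scope.
Implicit Types (la sg : intpart).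

Lemma intpart_dec la r : nth 0 la r.+1 <= nth 0 la r.
Proof.
have [rs|sr] := ltnP r.+1 (size la); last by rewrite nth_default.
case/andP: (valP la) => sla _.
have geq_trans : transitive geq by move=> x y w yx xw; exact: leq_trans xw yx.
by apply: (sorted_leq_nth geq_trans leqnn 0 sla); rewrite ?inE // ltnW.
Qed.

Lemma intpart_shape N la : size la <= N -> shape N (nth 0 la).
Proof. by move=> laN; split=> [r|]; [apply: intpart_dec|rewrite nth_default]. Qed.

Lemma intpart_homo la r s : r <= s -> nth 0 la s <= nth 0 la r.
Proof. exact: shape_homo (intpart_shape (leqnn _)). Qed.

Lemma nth_intpart_gt0 la r : (0 < nth 0 la r) = (r < size la).
Proof.
case: (ltnP r (size la)) => rs; last by rewrite nth_default.
case/andP: (valP la) => _; rewrite lt0n => N0; apply/eqP => r0.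
by have := mem_nth 0 rs; rewrite r0 (negbTE N0).
Qed.

Lemma intpart_ext la sg : nth 0 la =1 nth 0 sg -> la = sg.
Proof.
move=> lasg; apply: val_inj; apply: (@eq_from_nth _ 0) => //.
have size_le (l s : intpart) : nth 0 l =1 nth 0 s -> size l <= size s.
  move=> ls; rewrite leqNgt; apply/negP; rewrite -nth_intpart_gt0 ls.
  by rewrite nth_default.
by apply/eqP; rewrite eqn_leq !size_le.
Qed.

Lemma box_ex sg r c : in_diagram sg r c -> exists b : box sg, box_row b = r /\ box_col b = c.
Proof.
move=> cr; have rs : r < size sg.
  by rewrite -nth_intpart_gt0; apply: leq_ltn_trans cr.
by exists (Tagged (fun r : 'I_(size sg) => 'I_(nth 0 sg r))
  (Ordinal cr : 'I_(nth 0 sg (Ordinal rs)))).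
Qed.

Lemma box_eq sg (b b' : box sg) : box_row b = box_row b' -> box_col b = box_col b' -> b = b'.
Proof.
case: b b' => [r c] [r' c'] /=; rewrite /box_row /box_col /= => /val_inj rr.
by case: r' / rr c' => c' /val_inj ->.
Qed.

Lemma box_in sg (b : box sg) : in_diagram sg (box_row b) (box_col b).
Proof. exact: ltn_ord. Qed.

Lemma card_skew la sg :
  #|skew_boxes la sg| = \sum_(0 <= r < size sg) (nth 0 sg r - nth 0 la r).
Proof.
rewrite -sum1_card big_mkord.
under eq_bigl => b do rewrite inE /in_diagram -leqNgt.
rewrite -(@sig_big_dep _ _ _ _ (fun r : 'I_(size sg) => 'I_(nth 0 sg r)) xpredT
  (fun (r : 'I_(size sg)) (c : 'I_(nth 0 sg r)) => nth 0 la r <= c) (fun _ _ => 1)) /=.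
apply: eq_bigr => r _; rewrite big_mkcond /=.
transitivity (\sum_(nth 0 la r <= c < nth 0 sg r) 1); last by rewrite sum_nat_const_nat muln1.
rewrite (@big_nat_ord _ _ _ _ _ (nth 0 sg r)) //; apply: eq_bigr => c _.
by rewrite ltn_ord andbT.
Qed.

Lemma card_skew_rows la sg t i : t <= i -> i < size sg ->
  (forall r, ~~ (t <= r <= i) -> nth 0 sg r - nth 0 la r = 0) ->
  #|skew_boxes la sg| = \sum_(t <= r < i.+1) (nth 0 sg r - nth 0 la r).
Proof.
move=> ti i_sg off; rewrite card_skew.
rewrite (@big_cat_nat _ _ _ t) //=; last exact: ltnW (leq_ltn_trans ti i_sg).
rewrite (@big_cat_nat _ _ _ i.+1 t) //=; last exact: leqW.
rewrite big_nat big1 => [|r /andP[_ rt]]; last by apply: off; lia.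
rewrite [X in _ + (_ + X)]big_nat [X in _ + (_ + X)]big1 ?addn0 // => r /andP[ir _].
by apply: off; lia.
Qed.

(** A border strip in the rows [t, ..., i]: below row [t], each row ends one box
    to the right of the end of the row above it in the old shape.  In terms of
    beta-numbers, the new number of row [r + 1] is the old number of row [r],
    and that of row [t] is the old number of row [i] plus [K]. *)
Record strip_shape K (f g : nat -> nat) t i : Prop := StripShape {
  strip_le : t <= i;
  strip_above : forall r, r < t -> g r = f r;
  strip_below : forall r, i < r -> g r = f r;
  strip_mid : forall r, t <= r -> r < i -> g r.+1 = (f r).+1;
  strip_top : f t < g t;
  strip_size : g t + (i - t) = f i + K }.

Lemma strip_sum (f g : nat -> nat) t i : (forall r, f r.+1 <= f r) -> t <= i -> f t <= g t ->
  (forall r, t <= r -> r < i -> g r.+1 = (f r).+1) ->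
  \sum_(t <= r < i.+1) (g r - f r) + f i = g t + (i - t).
Proof.
move=> f_dec ti fgt mid; rewrite -(subnK ti) addnC.
have {mid ti}: forall r, t <= r -> r < t + (i - t) -> g r.+1 = (f r).+1.
  by rewrite subnKC.
rewrite addnC; elim: (i - t) => [|k IH] mid.
  by rewrite add0n subnn big_nat1; lia.
rewrite addSn big_nat_recr /=; last by rewrite leqW // leq_addl.
have mid' : forall r, t <= r -> r < k + t -> g r.+1 = (f r).+1.
  by move=> r tr rk; apply: mid => //; lia.
have -> : g (k + t).+1 = (f (k + t)).+1 by apply: mid; lia.
by have := f_dec (k + t); have := IH mid'; lia.
Qed.

Section OneStrip.
Variables (la sg : intpart) (K t i : nat).
Let f := nth 0 la.
Let g := nth 0 sg.

Lemma strip_row_gt : strip_shape K f g t i -> forall r, (f r < g r) = (t <= r <= i).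
Proof.
case=> ti above below mid top _ r.
have [rt|tr] /= := ltnP r t; first by rewrite above // ltnn.
have [ir|ri] := ltnP i r; first by rewrite below // ltnn.
move: tr; rewrite leq_eqVlt => /orP[/eqP <- //|]; case: r ri => // r ri tr.
by rewrite mid // ltnS intpart_dec.
Qed.

Lemma strip_contained : strip_shape K f g t i -> contained la sg.
Proof.
move=> st r c; rewrite /in_diagram -/(f r) -/(g r) => /leq_trans; apply.
have := strip_row_gt st r; case: (ltnP (f r)) => [/ltnW //|_ /esym/negbT].
rewrite negb_and -!ltnNge => /orP[rt|ir]; first by rewrite (strip_above st).
by rewrite (strip_below st).
Qed.

Lemma strip_bottom_size : strip_shape K f g t i -> i < size sg.
Proof.
move=> st; rewrite -nth_intpart_gt0 -/(g i); have := strip_row_gt st i.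
by rewrite (strip_le st) leqnn; apply: leq_ltn_trans.
Qed.

Lemma strip_card : strip_shape K f g t i -> #|skew_boxes la sg| = K.
Proof.
move=> st; have ti := strip_le st.
rewrite (card_skew_rows ti (strip_bottom_size st)) => [|r]; last first.
  by rewrite -(strip_row_gt st) -leqNgt /leq => /eqP.
have := strip_sum (intpart_dec la) ti (ltnW (strip_top st)) (strip_mid st).
by have := strip_size st; rewrite -/f -/g; lia.
Qed.

Lemma strip_no_square : strip_shape K f g t i -> ~ has_square la sg.
Proof.
move=> st [r [c sq]].
have /andP[] := sq 0 0 isT isT; have /andP[] := sq 1 1 isT isT.
rewrite /in_diagram !addn0 !addn1 -/(f r) -/(f r.+1) -/(g r) -/(g r.+1) -!leqNgt.
move=> cg fc cg' fc'.
have : (f r < g r) by apply: leq_ltn_trans cg'.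
have : (f r.+1 < g r.+1) by apply: leq_ltn_trans cg.
rewrite !(strip_row_gt st) => /andP[_ ri] /andP[tr _].
by move: cg; rewrite (strip_mid st) // ltnS ltnNge fc'.
Qed.

(** From every box of the strip one reaches the leftmost box of row [i], by
    moving left in a row as far as possible and then down; the quantity that
    decreases is the column plus the distance to row [i]. *)
Lemma strip_skew_connected : strip_shape K f g t i -> skew_connected la sg.
Proof.
move=> st; pose e := [rel x y |
  [&& x \in skew_boxes la sg, y \in skew_boxes la sg & adjacent x y]].
have e_sym : symmetric e.
  move=> x y; rewrite /= andbCA; congr [&& _, _ & _]; rewrite /adjacent.
  rewrite [box_row y == _]eq_sym [box_col y == _]eq_sym.
  by rewrite [X in _ && X || _]orbC [X in _ || _ && X]orbC.
have cs := sym_connect_sym e_sym.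
have ti := strip_le st.
have inS (b : box sg) : (b \in skew_boxes la sg) = (f (box_row b) <= box_col b).
  by rewrite inE /in_diagram -leqNgt.
have fgi : f i < g i by rewrite (strip_row_gt st) ti leqnn.
have [b0 [b0r b0c]] := box_ex fgi.
suff to0 b : b \in skew_boxes la sg -> connect e b b0.
  by move=> b b' bS b'S; rewrite (connect_trans (to0 b bS)) // cs to0.
have [m] := ubnP (box_col b + (i - box_row b)); elim: m b => // m IH b; rewrite ltnS => bm bS.
have /andP[tr ri] : t <= box_row b <= i.
  by rewrite -(strip_row_gt st); move: bS (box_in b); rewrite inS; apply: leq_ltn_trans.
have next r c : f r <= c -> c < g r ->
    (box_row b == r) && (c.+1 == box_col b) || (box_col b == c) && ((box_row b).+1 == r) ->
    c + (i - r) < m -> connect e b b0.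
  move=> fc cg adj lt_m; have [b' [b'r b'c]] := box_ex cg.
  have b'S : b' \in skew_boxes la sg by rewrite inS b'r b'c.
  apply: (@connect_trans _ _ b'); last by apply: IH; rewrite // b'r b'c.
  apply: connect1; rewrite /= bS b'S /adjacent b'r b'c.
  by case/orP: adj => /andP[-> ->]; rewrite ?orbT.
have cg := box_in b; rewrite /in_diagram -/(g _) in cg.
have := bS; rewrite inS leq_eqVlt => /orP[/eqP fc|fc]; last first.
  apply: (next (box_row b) (box_col b).-1); lia.
move: ri; rewrite leq_eqVlt => /orP[/eqP ri|ri].
  rewrite (_ : b = b0) //; apply: box_eq; first by rewrite b0r.
  by rewrite b0c -fc ri.
apply: (next (box_row b).+1 (box_col b)).
- by rewrite -fc intpart_dec.
- by rewrite (strip_mid st) // ltnS fc.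
- by rewrite !eqxx orbT.
- by lia.
Qed.

Lemma strip_heightE : strip_shape K f g t i -> strip_height la sg = i - t.
Proof.
move=> st; have ti := strip_le st.
have i_sg := strip_bottom_size st.
rewrite /strip_height (_ : skew_rows la sg = [set r : 'I_(size sg) | t <= r <= i]%SET).
  rewrite -sum1dep_card big_mkcond /=.
  have := @big_nat_ord _ 0 addn t i.+1 (size sg) (fun _ => 1) i_sg.
  under [in X in _ = X -> _]eq_bigr => r _ do rewrite ltnS.
  by move=> <-; rewrite sum_nat_const_nat muln1 subSn.
apply/setP => r; rewrite inE -(strip_row_gt st); apply/imsetP/idP.
  move=> [b]; rewrite inE /in_diagram -leqNgt => fb ->.
  exact: leq_ltn_trans fb (box_in b).
move=> fg; have [b [br bc]] := box_ex (sg := sg) fg; exists b.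
  by rewrite inE /in_diagram br bc ltnn.
exact/esym/val_inj.
Qed.

End OneStrip.

(** Let [t] and [i] be the first and the last row of the strip.  For [r] between
    them, the boxes shared by the columns of rows [r] and [r + 1] of the strip
    are those from [f r] to [g r.+1 - 1].  There is at least one, for otherwise
    no path crosses from row [r] to row [r + 1], and at most one, for two form
    a square.  The number of boxes determines the remaining row [t]. *)
Lemma adds_border_stripP K la sg : 0 < K ->
  adds_border_strip K la sg <-> exists t i, strip_shape K (nth 0 la) (nth 0 sg) t i.
Proof.
move=> K0; split=> [[cont conn card nsq]|[t [i st]]]; last first.
  split; [exact: strip_contained st | exact: strip_skew_connected st
    | exact: strip_card st | exact: strip_no_square st].
set f := nth 0 la; set g := nth 0 sg.
have fg r : f r <= g r.
  case fE: (f r) => [//|c]; have := cont r c; rewrite /in_diagram -/(f r) -/(g r) fE.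
  exact.
have gP r : f r < g r -> r < size sg.
  by rewrite -nth_intpart_gt0; apply: leq_ltn_trans.
have ex : exists r, f r < g r.
  have /card_gt0P[b] : 0 < #|skew_boxes la sg| by rewrite card.
  rewrite inE /in_diagram -leqNgt => fb; exists (box_row b).
  exact: leq_ltn_trans fb (box_in b).
case: (ex_minnP ex) => t ft t_min.
case: (ex_maxnP ex (fun r h => ltnW (gP r h))) => i fi i_max.
have ti : t <= i by apply: t_min.
have eqfg r : ~~ (t <= r <= i) -> g r = f r.
  move=> ntri; apply/eqP; rewrite eqn_leq fg andbT leqNgt; apply: contra ntri => fgr.
  by rewrite t_min //= i_max.
have mid r : t <= r -> r < i -> g r.+1 = (f r).+1.
  move=> tr ri; apply/eqP; rewrite eqn_leq.
  apply/andP; split; rewrite leqNgt; apply/negP => lt.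
    (* two shared columns: the square with upper left corner [(r, f r)] *)
    apply: nsq; exists r, (f r) => u v u2 v2.
    rewrite /in_diagram -leqNgt -/f -/g.
    have gr1 := intpart_dec sg r; have fr1 := intpart_dec la r; rewrite -/f -/g in gr1 fr1.
    by move: u v u2 v2 => [|[|//]] [|[|//]] _ _; rewrite ?addn0 ?addn1; apply/andP; split; lia.
  (* no shared column: the rows up to [r] are closed under adjacency *)
  have [bt [btr btc]] := box_ex (sg := sg) ft; have [bi [bir bic]] := box_ex (sg := sg) fi.
  have btS : bt \in skew_boxes la sg by rewrite inE /in_diagram btr btc ltnn.
  have biS : bi \in skew_boxes la sg by rewrite inE /in_diagram bir bic ltnn.
  pose e := [rel x y |
  [&& x \in skew_boxes la sg, y \in skew_boxes la sg & adjacent x y]].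
  have cn : connect e bt bi := conn _ _ btS biS.
  have clos : closed e [pred b : box sg | box_row b <= r].
    move=> x y /and3P[]; rewrite !inE /in_diagram -!leqNgt -/f => xS yS.
    have := box_in x; have := box_in y; rewrite /in_diagram -/g => yg xg.
    case/orP => /andP[/eqP E]; first by rewrite E.
    case/orP => /eqP E'.
      have : box_row x <> r by move=> Er; move: xS yg; rewrite -E' Er -E; lia.
      by lia.
    have : box_row y <> r by move=> Er; move: yS xg; rewrite -E' Er E; lia.
    by lia.
  by have := closed_connect clos cn; rewrite !inE btr bir tr leqNgt ri.
exists t, i; split=> //.
- by move=> r rt; apply: eqfg; lia.
- by move=> r ir; apply: eqfg; lia.
have := strip_sum (intpart_dec la) ti (ltnW ft) mid.
rewrite -(card_skew_rows ti (gP _ fi)) ?card => [|r]; first by rewrite addnC.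
by move=> /eqfg; rewrite /f /g => ->; rewrite subnn.
Qed.

End Strips.

Section StripShapes.
Local Open Scope nat_scope.

Lemma intpart_of N (g : nat -> nat) : shape N g -> exists sg : intpart, nth 0 sg =1 g.
Proof.
elim: N g => [|N IH] g gs.
  exists (@IntPart [::] isT) => r /=; rewrite nth_nil; apply/esym/eqP.
  by rewrite -leqn0 -(proj2 gs) (shape_homo gs).
have [g0|g0] := posnP (g 0).
  exists (@IntPart [::] isT) => r /=; rewrite nth_nil; apply/esym/eqP.
  by rewrite -leqn0 -g0 (shape_homo gs).
have [[s sP] /= sE] : exists sg : intpart, nth 0 sg =1 (fun r => g r.+1).
  by apply: IH; split=> [r|]; [apply: (proj1 gs)|apply: (proj2 gs)].
have P : sorted geq (g 0 :: s) && (0 \notin g 0 :: s).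
  case/andP: sP => s_sorted s0; rewrite inE negb_or s0 andbT eq_sym -lt0n g0 andbT.
  case: (s) (sE 0) s_sorted => //= x s' -> ->.
  by rewrite andbT; apply: (proj1 gs).
by exists (IntPart P) => -[|r] //=; rewrite sE.
Qed.

(** Row [t] is the first whose beta-number is less than [beta f i + K]: this is
    where the raised number belongs in the sorted sequence. *)
Lemma strip_shape_ex N K (f : nat -> nat) (i : 'I_N) : 0 < K -> shape N f ->
  (forall l : 'I_N, beta f l <> beta f i + K) ->
  exists (sg : intpart) t, strip_shape K f (nth 0 sg) t i.
Proof.
move=> K0 fs nb; have [f_dec fN] := fs.
pose low t := f t + (N - t.+1) < beta f i + K.
have ex : exists t, low t by exists (i : nat); rewrite /low /beta; lia.
case: (ex_minnP ex) => t lt_t t_min.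
have ti : t <= i by apply: t_min; rewrite /low /beta; lia.
have iN := ltn_ord i.
have top : f t + (i - t) < f i + K by move: lt_t; rewrite /low /beta; lia.
have above r : r.+1 = t -> f i + K <= f r + (i - t).
  move=> rt; have rN : r < N by lia.
  have : ~~ low r by apply/negP => /t_min; lia.
  by rewrite /low; have := nb (Ordinal rN); rewrite /beta /=; lia.
pose g r := if r < t then f r else if r == t then f i + K - (i - t)
            else if r <= i then (f r.-1).+1 else f r.
have gA r : r < t -> g r = f r by rewrite /g => ->.
have gT : g t = f i + K - (i - t) by rewrite /g ltnn eqxx.
have gM r : t <= r -> r < i -> g r.+1 = (f r).+1.
  by move=> tr ri; rewrite /g ltnNge (leqW tr) /= gtn_eqF // ri.
have gB r : i < r -> g r = f r.
  move=> ir; have tr := leq_ltn_trans ti ir.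
  by rewrite /g ltnNge (ltnW tr) /= gtn_eqF // leqNgt ir.
have gs : shape N g.
  split=> [r|]; last by rewrite gB.
  have [rt|tr] := ltnP r t.
    rewrite (gA r) //; have := above r; case: (ltngtP r.+1 t) => h; last by rewrite h gT; lia.
      by rewrite gA.
    by lia.
  have fg : f r + (r <= i) <= g r.
    have [ri|ir] := leqP r i; last by rewrite addn0 gB.
    move: tr; rewrite leq_eqVlt => /orP[/eqP <-|]; first by rewrite gT; lia.
    by case: r ri => // r ri tr; rewrite gM // addn1 ltnS.
  have [ri|ir] := ltnP r i; first by rewrite gM // -addn1; move: fg; rewrite (ltnW ri).
  by rewrite gB // (leq_trans (f_dec r)) // (leq_trans _ fg) // leq_addr.
have [sg sgE] := intpart_of gs; exists sg, t; split=> //.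
- by move=> r rt; rewrite sgE gA.
- by move=> r ir; rewrite sgE gB.
- by move=> r tr ri; rewrite sgE gM.
- by rewrite sgE gT; lia.
- by rewrite sgE gT; lia.
Qed.

(** The raised number has only one place in the sorted sequence, so the bottom
    row of a border strip determines the strip. *)
Lemma strip_shape_uniq K la (sg sg' : intpart) t t' i :
  strip_shape K (nth 0 la) (nth 0 sg) t i -> strip_shape K (nth 0 la) (nth 0 sg') t' i ->
  sg = sg'.
Proof.
have no (s s' : intpart) u u' : strip_shape K (nth 0 la) (nth 0 s) u i ->
    strip_shape K (nth 0 la) (nth 0 s') u' i -> u' <= u.
  move=> s_ s'_; rewrite leqNgt; apply/negP => uu'.
  have := strip_size s_; have := strip_size s'_; have := strip_top s_.
  have := strip_le s'_.
  have := strip_above s'_ uu'; have := intpart_homo s' (ltnW uu').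
  by lia.
move=> s_ s'_; have tt : t = t'.
  by apply/eqP; rewrite eqn_leq (no _ _ _ _ s_ s'_) (no _ _ _ _ s'_ s_).
rewrite -{t'}tt in s'_; apply: intpart_ext => r.
have [rt|tr] := ltnP r t; first by rewrite (strip_above s_) ?(strip_above s'_).
have [ir|ri] := ltnP i r; first by rewrite (strip_below s_) ?(strip_below s'_).
move: tr; rewrite leq_eqVlt => /orP[/eqP <-|].
  by have := strip_size s_; have := strip_size s'_; lia.
case: r ri => // r ri tr; by rewrite (strip_mid s_) ?(strip_mid s'_).
Qed.

Lemma strip_bottom_lt K la (sg : intpart) t i :
  strip_shape K (nth 0 la) (nth 0 sg) t i -> i < size la + K.
Proof.
move=> st; rewrite ltnNge; apply/negP => Ni.
have fi : nth 0 la i = 0 by rewrite nth_default //; lia.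
have := strip_size st; have := strip_top st; have := strip_le st; rewrite fi.
case: t st => [|t] st; first by lia.
have := intpart_dec sg t; rewrite (strip_above st (ltnSn t)) => gt.
have [tl|lt] := ltnP t (size la); first by lia.
by rewrite (nth_default _ lt) in gt *; lia.
Qed.

Lemma strip_not_beta N K (la sg : intpart) t (i : 'I_N) : 
  strip_shape K (nth 0 la) (nth 0 sg) t i ->
  forall l : 'I_N, beta (nth 0 la) l <> beta (nth 0 la) i + K.
Proof.
move=> st l; have := strip_size st; have := strip_le st; have := ltn_ord l; have := ltn_ord i.
rewrite /beta => iN lN ti gt.
have [lt|tl] := ltnP l t.
  by have := strip_above st lt; have := intpart_homo sg (ltnW lt); lia.
have [li|il] := ltnP l i.
  by have := strip_mid st tl li; have := intpart_homo sg (leqW tl); lia.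
by have := intpart_homo la il; have := strip_top st; have := intpart_homo la tl; lia.
Qed.

Lemma strip_size_le K (la sg : intpart) t i :
  strip_shape K (nth 0 la) (nth 0 sg) t i -> size sg <= size la + K.
Proof.
move=> st; rewrite leqNgt -nth_intpart_gt0 (strip_below st (strip_bottom_lt st)).
by rewrite nth_default ?leq_addr.
Qed.

Lemma strip_row0_le K (la sg : intpart) t i :
  strip_shape K (nth 0 la) (nth 0 sg) t i -> nth 0 sg 0 <= nth 0 la 0 + K.
Proof.
case: t => [|t] st; last by rewrite (strip_above st) // leq_addr.
by have := strip_size st; have := intpart_homo la (leq0n i); lia.
Qed.

End StripShapes.

Section SumOverStrips.
Variables (R : comNzRingType) (z : nat -> nat -> R).

(** Sorting moves row [i] up to place [t] past [i - t] other rows. *)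
Lemma det_jt_strip N K M (la sg : intpart) t (i : 'I_N) :
  strip_shape K (nth 0%N la) (nth 0%N sg) t i ->
  \det (jt z M (bump_at K (beta (nth 0%N la)) i)) =
  (-1) ^+ (i - t) * \det (jt z M (@beta N (nth 0%N sg))).
Proof.
case: N i => [[]//|N] i st; have ti := strip_le st.
have tN : (t < N.+1)%N := leq_ltn_trans ti (ltn_ord i).
pose s := lift_perm (Ordinal tN) i 1%g.
set A := jt z M _; have -> : jt z M (@beta N.+1 (nth 0%N sg)) = row_perm s A.
  apply/matrixP => l j; rewrite !mxE; congr (complete z M _ _).
  rewrite /bump_at /s; have := ltn_ord i; have := strip_size st.
  case: (unliftP (Ordinal tN) l) => [k|] ->; last first.
    by rewrite lift_perm_id eqxx muln1 /beta /=; lia.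
  move: (k : 'I_N) => {}k.
  rewrite lift_perm_lift perm1 eq_sym (negbTE (neq_lift _ _)) muln0 addn0 /beta /=.
  have := ltn_ord k; rewrite /bump => kN gt iN.
  have [tk|kt] := leqP t k; have [ik|ki] := leqP i k.
  - by rewrite !add1n (strip_below st).
  - by rewrite add1n add0n (strip_mid st) //; lia.
  - by lia.
  - by rewrite !add0n (strip_above st).
rewrite row_permE det_mulmx det_perm /s odd_lift_perm odd_perm1 addbF mulrA.
by rewrite -signr_odd oddB // addbC -signr_addb addbb mul1r.
Qed.

(** The theorem for finitely many values and any weights of period [K]: the
    border strips correspond to the beta-numbers that can be raised by [K]
    without meeting another one. *)
Lemma tabsum_strips K M E B (la : intpart) : (0 < K)%N ->
  (forall v p, z v (p + K)%N = z v p) -> (M <= E)%N -> (nth 0%N la 0 + K <= B)%N ->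
  let N := (size la + K)%N in
  (\sum_(v < M) \prod_(0 <= p < K) z v p) * tabsum z N B E M (nth 0%N la) =
  \sum_(sg \in [set sg | adds_border_strip K la sg])
     (-1) ^+ strip_height la sg * tabsum z N B E M (nth 0%N sg).
Proof.
move=> K0 zK ME fB N.
have lash : shape N (nth 0%N la) := intpart_shape (leq_addr _ _).
pose b := @beta N (nth 0%N la).
rewrite tabsum_jt //; last by rewrite ltnS; lia.
rewrite -(jt_power_sum K0 zK); last first.
  move=> q qK; have qN : (N - q.+1 < N)%N by rewrite /N; lia.
  exists (Ordinal qN); rewrite /beta /= nth_default /N; lia.
pose D : pred 'I_N := fun i => [forall l, b l != (b i + K)%N].
have sg_ex (i : 'I_N) :
    exists sg : intpart, D i -> exists t, strip_shape K (nth 0%N la) (nth 0%N sg) t i.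
  have [Di|nD] := boolP (D i); last by exists la.
  have [|sg [t st]] := @strip_shape_ex N K (nth 0%N la) i K0 lash.
    by move=> l; apply/eqP; move/forallP: Di; apply.
  by exists sg => _; exists t.
have [sgf sgfP] := choice sg_ex.
have bij : set_bij [set` enum D]%classic [set sg | adds_border_strip K la sg]%classic sgf.
  split.
  - move=> i /=; rewrite mem_enum => /sgfP[t st]; apply/adds_border_stripP => //.
    by exists t, i.
  - move=> i j; rewrite !inE /= !mem_enum => /sgfP[t st] /sgfP[u su] ij.
    rewrite -ij in su; apply/val_inj/eqP; rewrite eqn_leq.
    have := strip_row_gt st j; rewrite (strip_row_gt su) leqnn (strip_le su) /=.
    have := strip_row_gt su i; rewrite (strip_row_gt st) leqnn (strip_le st) /=.
    by move=> /esym/andP[_ ->] /esym/andP[_ ->].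
  - move=> sg /= /(adds_border_stripP _ _ K0)[t [i st]].
    have iN := strip_bottom_lt st; rewrite -/N in iN.
    have Di : D (Ordinal iN).
      by apply/forallP => l; apply/eqP; apply: (@strip_not_beta N K la sg t (Ordinal iN)).
    exists (Ordinal iN) => /=; first by rewrite mem_enum.
    by have [u su] := sgfP _ Di; apply: (strip_shape_uniq su st).
rewrite (@reindex_fsbig _ _ _ 'I_N intpart sgf [set` enum D]%classic _ _ bij).
rewrite -fsbig_seq ?enum_uniq // big_enum /=.
rewrite [LHS](bigID D) /= [X in _ + X]big1 ?addr0.
  apply: eq_bigr => i /sgfP[t st].
  rewrite (det_jt_strip M st) (strip_heightE st) tabsum_jt //.
    exact: intpart_shape (strip_size_le st).
  by rewrite ltnS (leq_trans (strip_row0_le st)).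
move=> i; rewrite negb_forall => /existsP[l]; rewrite negbK => /eqP bl.
have il : i != l by apply/eqP => il; move: bl; rewrite il; lia.
apply: (determinant_alternate il) => j; rewrite !mxE /bump_at -/b bl.
by rewrite eqxx muln1 eq_sym (negbTE il) muln0 addn0.
Qed.

End SumOverStrips.

(** * From finitely many values to power series *)

Definition posnatS (v : nat) : posnat := exist (fun j => (0 < j)%N) v.+1 isT.

Lemma posnatSK (j : posnat) : posnatS (val j).-1 = j.
Proof. by apply: val_inj; case: j => j j0; rewrite /= prednK. Qed.

Section Truncation.
Variable n : nat.
Implicit Types (f g : fps (loop_var n)).

(** Agreement in the coefficients of the monomials that involve only the values
    [1, ..., M].  It is compatible with products, since the divisors of such a
    monomial are again of this kind. *)
Definition eq_upto M f g := forall m : {cmonom loop_var n},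
  (forall v, v \in finsupp m -> (val v.2 <= M)%N) -> f m = g m.

Lemma eq_upto_mul M f f' g g' :
  eq_upto M f f' -> eq_upto M g g' -> eq_upto M (f * g) (f' * g').
Proof.
move=> ff gg m mM; rewrite !fps_coefM; apply: eq_fsbigr => -[a b].
rewrite inE /= => abm.
have sub_m (c d : {cmonom loop_var n}) : mmul c d = m ->
    forall v, v \in finsupp c -> (val v.2 <= M)%N.
  move=> cdm v vc; apply: mM; rewrite -cmE_neq0 -cdm cmM.
  by move: vc; rewrite -cmE_neq0; lia.
by rewrite (ff _ (sub_m _ _ abm)) (gg _ (sub_m b a _)) // mulmC.
Qed.

Lemma coef_sum (T : Type) (r : seq T) (P : pred T) (F : T -> fps (loop_var n)) m :
  (\sum_(t <- r | P t) F t) m = \sum_(t <- r | P t) F t m.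
Proof. exact: (big_morph (fun f : fps (loop_var n) => f m)). Qed.

Lemma eq_upto_fsbig M (T : choiceType) (X : set T) (F G : T -> fps (loop_var n)) :
  finite_set X -> (forall t, X t -> eq_upto M (F t) (G t)) ->
  eq_upto M (\sum_(t \in X) F t) (\sum_(t \in X) G t).
Proof.
move=> Xfin FG m mM; rewrite !(fsbig_finite _ _ Xfin) !coef_sum.
rewrite !big_seq; apply: eq_bigr => t; rewrite in_fset_set // inE => Xt.
exact: FG.
Qed.

Lemma loop_power_sum_upto k M : (0 < k)%N ->
  eq_upto M (loop_power_sum n k)
    (\sum_(v < M) (\prod_(i : color n) loop_x i (posnatS v)) ^+ k).
Proof.
move=> k0 m mM; rewrite coef_sum.
rewrite -(big_mkord xpredT
  (fun v => ((\prod_(i : color n) loop_x i (posnatS v)) ^+ k) m)).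
rewrite /loop_power_sum /fps_sum /=.
rewrite (@fsbigE _ _ _ _ _ [seq posnatS v | v <- index_iota 0 M]).
- rewrite big_map; apply: eq_bigl => v; by rewrite mem_set.
- by rewrite map_inj_uniq ?iota_uniq // => u v [].
- by [].
move=> j _ jr; apply/eqP; apply: contraNT jr.
rewrite -[k]card_ord -prodr_const pair_big /=.
move=> /(prod_fps_var_supp (Ordinal k0, 0)) /= /mM /= jM.
rewrite -(posnatSK j) map_f // mem_index_iota /=.
by case: j jM => j j0 /=; lia.
Qed.

End Truncation.

Section Colors.
Variables (n : nat) (n0 : (0 < n)%N).

Lemma inZpD (a b : nat) : inZp (a + b) = inZp a + inZp b :> color n.
Proof. by apply: val_inj; rewrite /= modnDm. Qed.

Lemma inZp_period k a : inZp (a + k * n) = inZp a :> color n.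
Proof. by apply: val_inj; rewrite /= prednK // addnC modnMDl. Qed.

(** The content of a box at position [p] is [p - (N - 1)]. *)
Definition loop_z (N v p : nat) : fps (loop_var n) :=
  loop_x (inZp p - inZp N.-1) (posnatS v).

Lemma loop_z_period N k v p : loop_z N v (p + k * n) = loop_z N v p.
Proof. by rewrite /loop_z inZp_period. Qed.

(** Any [n] consecutive positions carry each color once. *)
Lemma prod_loop_z N k v :
  \prod_(0 <= p < k * n) loop_z N v p = (\prod_(i : color n) loop_x i (posnatS v)) ^+ k.
Proof.
have one : \prod_(0 <= p < n) loop_z N v p = \prod_(i : color n) loop_x i (posnatS v).
  rewrite [RHS](reindex_inj (addIr (- inZp N.-1))) /=.
  have -> : \prod_(0 <= p < n) loop_z N v p = \prod_(0 <= p < n.-1.+1) loop_z N v p.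
    by congr (\big[_/_]_(_ <= _ < _) _); rewrite prednK.
  rewrite big_mkord; apply: eq_bigr => i _.
  by rewrite /loop_z valZpK.
elim: k => [|k IH]; first by rewrite mul0n big_geq // expr0.
rewrite mulSn (@big_cat_nat _ _ _ n) ?leq_addr //= one exprS; congr (_ * _).
have -> : \prod_(n <= p < n + k * n) loop_z N v p =
    \prod_(0 + n <= p < k * n + n) loop_z N v p by rewrite add0n addnC.
rewrite big_addn addnK -IH; apply: eq_bigr => p _.
by have := loop_z_period N 1 v p; rewrite mul1n.
Qed.

End Colors.

Section Boxes.
Variables (n : nat) (N B M : nat) (sg : intpart).
Hypotheses (sN : (size sg <= N)%N) (sB : (nth 0%N sg 0 <= B)%N).
Notation grid := ('I_N * 'I_B.+1)%type.
Notation filling := {ffun grid -> 'I_M.+1}.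
Let f := nth 0%N sg.

Lemma row_leB r : (nth 0%N sg r <= B.+1)%N.
Proof. by apply: leqW; apply: leq_trans sB; apply: intpart_homo. Qed.

Definition cell (b : box sg) : grid :=
  (widen_ord sN (tag b), widen_ord (row_leB (tag b)) (tagged b)).

Lemma cell_inj : injective cell.
Proof. by move=> b b' [rr cc]; apply: box_eq. Qed.

Lemma cell_ex (p : grid) : (p.2 < f p.1)%N -> exists b, cell b = p.
Proof.
move=> pf; have [b [br bc]] := box_ex (sg := sg) pf; exists b.
by case: p br bc {pf} => r c /= br bc; congr (_, _); apply: val_inj.
Qed.

Lemma cell_in b : ((cell b).2 < f (cell b).1)%N.
Proof. exact: box_in. Qed.

(** Values of a filling of the rectangle start at 0, those of a tableau at 1. *)
Definition entries (T : filling) : {ffun box sg -> posnat} :=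
  [ffun b => posnatS (T (cell b))].

Definition word_weight (w : {ffun box sg -> posnat}) : fps (loop_var n) :=
  \prod_b loop_x (box_color n b) (w b).

Lemma weight_entries T : weight (loop_z n N) f T = word_weight (entries T).
Proof.
rewrite /weight -big_mkcond /= (eq_bigl (mem [set cell b | b : box sg]%SET)); last first.
  move=> p; apply/idP/imsetP => [/cell_ex[b <-]|[b _ ->]]; last exact: cell_in.
  by exists b.
rewrite big_imset /=; last by move=> b b' _ _; apply: cell_inj.
apply: eq_big => [b|b _]; first by rewrite inE.
rewrite [entries T b]ffunE /loop_z.
suff -> : inZp ((cell b).2 + (N - (cell b).1.+1)) - inZp N.-1 = box_color n b by [].
rewrite /box_color /= -/(box_col b) -/(box_row b).
apply/eqP; rewrite subr_eq addrAC eq_sym subr_eq -!inZpD; apply/eqP; congr inZp.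
have := ltn_ord (tag b); rewrite /box_row; move: sN.
by move: (box_col b) (nat_of_ord (tag b)) => c r; lia.
Qed.

Lemma entries_inj : {in tableau M f &, injective entries}.
Proof.
move=> T T' /asboolP tT /asboolP tT' rT; apply/ffunP => -[r c].
have [cf|fc] := ltnP c (f r); last by rewrite (tab_off tT) // (tab_off tT').
have [b <-] := cell_ex (p := (r, c)) cf; apply: val_inj.
by have := congr1 (fun w : {ffun box sg -> posnat} => val (w b)) rT; rewrite !ffunE /= => -[].
Qed.

Lemma entries_ssyt T : tableau M f T -> is_ssyt (entries T).
Proof.
move=> /asboolP tT; apply/forallP => b; apply/forallP => b'; rewrite !ffunE /=.
apply/andP; split; apply/implyP => /andP[/eqP E lt]; rewrite ltnS.
  have -> : cell b = ((cell b').1, (cell b).2) by congr (_, _); apply: val_inj.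
  by apply: (tab_row tT) => //; apply: (cell_in b').
have -> : cell b = ((cell b).1, (cell b').2) by congr (_, _); apply: val_inj.
by apply: (tab_col tT) => //; apply: (cell_in b').
Qed.

Lemma entries_surj (w : {ffun box sg -> posnat}) :
  is_ssyt w -> (forall b, val (w b) <= M)%N -> exists2 T, tableau M f T & entries T = w.
Proof.
move=> /forallP w_ssyt wM.
pose T : filling := [ffun p : grid =>
  if [pick b | cell b == p] is Some b then inord (val (w b)).-1 else ord0].
have wgt0 b : (0 < val (w b))%N by case: (w b).
have TE b : T (cell b) = (val (w b)).-1 :> nat.
  rewrite ffunE; case: pickP => [b' /eqP/cell_inj ->|/(_ b)]; last by rewrite eqxx.
  by rewrite inordK // ltnS (leq_trans (leq_pred _)).
exists T; last by apply/ffunP => b; rewrite ffunE -[RHS]posnatSK TE.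
apply/asboolP; split=> [r c|r c|r c c'|r r' c].
- move=> cf; have [b <-] := cell_ex (p := (r, c)) cf.
  by rewrite TE; have := wM b; have := wgt0 b; lia.
- move=> fc; rewrite ffunE; case: pickP => // b /eqP bp.
  by have := cell_in b; rewrite bp ltnNge fc.
- move=> cc' cf'; have cf := leq_ltn_trans cc' cf'.
  have [b bE] := cell_ex (p := (r, c)) cf; have [b' bE'] := cell_ex (p := (r, c')) cf'.
  rewrite -bE -bE' !TE; have /forallP/(_ b')/andP[/implyP + _] := w_ssyt b.
  have -> : box_row b = r by move: bE => [<-].
  have -> : box_row b' = r by move: bE' => [<-].
  have -> : box_col b = c by move: bE => [_ <-].
  have -> : box_col b' = c' by move: bE' => [_ <-].
  by rewrite eqxx cc' => /(_ isT); lia.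
- move=> rr' cf'; have cf : (c < f r)%N by apply: leq_trans cf' _; apply/intpart_homo/ltnW.
  have [b bE] := cell_ex (p := (r, c)) cf; have [b' bE'] := cell_ex (p := (r', c)) cf'.
  rewrite -bE -bE' !TE; have /forallP/(_ b')/andP[_ /implyP] := w_ssyt b.
  have -> : box_row b = r by move: bE => [<-].
  have -> : box_row b' = r' by move: bE' => [<-].
  have -> : box_col b = c by move: bE => [_ <-].
  have -> : box_col b' = c by move: bE' => [_ <-].
  by rewrite eqxx rr' => /(_ isT); have := wgt0 b; lia.
Qed.

(** A tableau that contributes to a monomial has no entries other than the
    values occurring in the monomial. *)
Lemma loop_schur_upto :
  eq_upto M (loop_schur n sg) (tabsum (loop_z n N) N B M M (nth 0%N sg)).
Proof.
move=> m mM; rewrite /loop_schur /fps_sum /=.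
have bij : set_bij [set: ssyt sg] [set w : {ffun box sg -> posnat} | is_ssyt w] val.
  split=> [T _|T T' _ _ /val_inj //|w ws]; first exact: (valP T).
  by exists (exist _ w ws).
rewrite -(@reindex_fsbig _ _ _ _ _ val _ _ (fun w => word_weight w m) bij).
rewrite (@fsbigE _ _ _ _ _ [seq entries T | T <- enum (tableau M f)]).
- rewrite big_map big_enum_cond /tabsum coef_sum; apply: eq_big => [T|T _].
    rewrite andb_idr // => /entries_ssyt rT; apply/mem_set; exact: rT.
  by rewrite weight_entries.
- rewrite map_inj_in_uniq ?enum_uniq // => T T'; rewrite !mem_enum; exact: entries_inj.
- by move=> w /= /mapP[T]; rewrite mem_enum => tT ->; apply: entries_ssyt.
move=> w ws wr; apply/eqP; apply: contraNT wr => wm.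
have [|T tT <-] := entries_surj ws; last by rewrite map_f // mem_enum.
move=> b; apply: (mM (box_color n b, w b)).
exact: (prod_fps_var_supp (v := fun b => (box_color n b, w b))).
Qed.

End Boxes.

Theorem theorem1 (n k : nat) (la : intpart)
    (hn : (1 <= n)%N) (hk : (1 <= k)%N) :
  loop_power_sum n k * loop_schur n la =
  \sum_(sg \in [set sg | adds_border_strip (k * n) la sg])
    (-1) ^+ strip_height la sg * loop_schur n sg.
Proof.
apply/fpsP => m; pose M := \max_(v <- finsupp m) val v.2.
have mM v : v \in finsupp m -> (val v.2 <= M)%N.
  by move=> vm; rewrite /M (big_fsetD1 v) //= leq_maxl.
have K0 : (0 < k * n)%N by rewrite muln_gt0 hn hk.
pose N := (size la + k * n)%N; pose B := (nth 0%N la 0 + k * n)%N.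
have la_upto := @loop_schur_upto n N B M la (leq_addr _ _) (leq_addr _ _).
rewrite (eq_upto_mul (loop_power_sum_upto (n := n) (M := M) hk) la_upto mM).
have strips := @tabsum_strips _ (@loop_z n N) (k * n) M M B la K0
  (@loop_z_period n hn N k) (leqnn M) (leqnn B).
cbv zeta in strips.
have power : \sum_(v < M) \prod_(0 <= p < k * n) loop_z n N v p =
  \sum_(v < M) (\prod_(i : color n) loop_x i (posnatS v)) ^+ k.
  by apply: eq_bigr => v _; apply: prod_loop_z.
rewrite power -/N in strips; rewrite strips.
apply/esym; apply: (eq_upto_fsbig _ _ mM); first exact: finite_border_strips.
move=> sg /= /(adds_border_stripP _ _ K0)[t [i st]].
by apply: eq_upto_mul => //; apply: loop_schur_upto;
  [exact: strip_size_le st | exact: strip_row0_le st].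
Qed.
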